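(* Let $(B,\|\cdot\|)$ be a Banach lattice and let $P$ be a positive operator on $B$. Assume that there exist two positive operators $K$ and $S$ on $B$ such that $K$ is compact, the positive part $(P-S)_+$ of $P-S$ is well defined, and $0\le P\le K+S$. Then $$r_{\mathrm{ess}}(P)\le r(S).$$
   Context: A linear operator $Q$ on a Banach lattice $B$ is positive if $Qf\ge 0$ for all $f\in B$ with $f\ge 0$ (positive operators are automatically bounded). For linear operators $P,Q$ on $B$, $0\le P\le Q$ means $0\le Pf\le Qf$ for all $f\in B$ with $f\ge 0$. $\|Q\|$ denotes the operator norm and $r(Q)$ the spectral radius of a bounded operator $Q$. The essential spectral radius of a bounded operator $Q$ on $B$ is $$r_{\mathrm{ess}}(Q):=\lim_{n\to\infty}\inf\{\|Q^n-K\|^{1/n}:K\in\mathcal K(B)\},$$ where $\mathcal K(B)$ is the set of compact operators on $B$. For a bounded linear operator $Q$ on $B$, the positive part $Q_+$ is said to be well defined if $Q_+f:=\sup\{Qg:\ g\in B,\ 0\le g\le f\}$, for $f\ge 0$, defines a positive linear operator on $B$. *)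

(* Defs.v *)
From HB Require Import structures.
From mathcomp Require Import all_boot all_order all_algebra.
From mathcomp Require Import complex.
From mathcomp Require Import all_classical all_reals all_analysis.

Set Implicit Arguments.
Unset Strict Implicit.
Unset Printing Implicit Defensive.

Import Order.TTheory GRing.Theory Num.Theory.
Import numFieldNormedType.Exports.

Local Open Scope classical_set_scope.
Local Open Scope ring_scope.

(* The order is carried by the structure itself rather than by [porderType]:
   HB admits no join of normed modules and ordered types that is not already an
   ancestor of [numDomainType]. *)
HB.mixin Record CompleteNormedModule_isBanachLattice (R : realType) B
    & CompleteNormedModule R B := {
  bl_le : rel B;
  bl_join : B -> B -> B;
  bl_meet : B -> B -> B;
  bl_le_refl : reflexive bl_le;
  bl_le_anti : antisymmetric bl_le;
  bl_le_trans : transitive bl_le;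
  bl_leUx : forall x y z : B,
    bl_le (bl_join x y) z = bl_le x z && bl_le y z;
  bl_lexI : forall x y z : B,
    bl_le z (bl_meet x y) = bl_le z x && bl_le z y;
  bl_leD2r : forall x y z : B, bl_le x y -> bl_le (x + z) (y + z);
  bl_leZ : forall (a : R) (x y : B),
    0 <= a -> bl_le x y -> bl_le (a *: x) (a *: y);
  (* [bl_join x (- x)] is the lattice modulus of [x]. *)
  bl_norm_solid : forall x y : B,
    bl_le (bl_join x (- x)) (bl_join y (- y)) -> `|x| <= `|y| :> R
}.

#[short(type="banachLatticeType")]
HB.structure Definition BanachLattice (R : realType) :=
  {B of CompleteNormedModule R B & CompleteNormedModule_isBanachLattice R B}.

Notation "x <=: y" := (bl_le x y) (at level 70, no associativity) : ring_scope.

Section Operators.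
Context {R : realType} {B : banachLatticeType R}.

Definition positive_operator (Q : B -> B) : Prop :=
  forall f : B, 0 <=: f -> 0 <=: Q f.

Definition positive_le (P Q : B -> B) : Prop :=
  forall f : B, 0 <=: f -> 0 <=: P f /\ P f <=: Q f.

Definition is_lub (A : set B) (m : B) : Prop :=
  (forall x, A x -> x <=: m) /\
  (forall z, (forall x, A x -> x <=: z) -> m <=: z).

Definition has_positive_part (Q : B -> B) : Prop :=
  exists T : {linear B -> B}, positive_operator T /\
    forall f : B, 0 <=: f ->
      is_lub [set Q g | g in [set g : B | 0 <=: g /\ g <=: f]] (T f).

Definition opnorm (Q : B -> B) : R :=
  sup [set `|Q x| | x in [set x : B | `|x| <= 1]].

Definition compact_operator (K : B -> B) : Prop :=
  precompact (K @` [set x : B | `|x| <= 1]).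

Definition ess_spectral_radius (Q : B -> B) : R :=
  limn (fun n : nat =>
    inf [set opnorm (iter n Q \- K) `^ n%:R^-1
        | K in [set K : {linear B -> B} | compact_operator K]]).

(* The complexification of [B] is [B * B], the pair [(x, y)] standing for
   [x + i y]. This is [l - Q] for the complexified operator
   [x + i y |-> Q x + i Q y]. *)
Definition complexified_sub (Q : B -> B) (l : R[i]) (u : B * B) : B * B :=
  (complex.Re l *: u.1 - complex.Im l *: u.2 - Q u.1,
   complex.Im l *: u.1 + complex.Re l *: u.2 - Q u.2).

(* The product norm of [B * B] is equivalent to the norm of the
   complexification, so both yield the same bounded operators; linearity of
   the inverse [V] is automatic. *)
Definition spectrum (Q : B -> B) : set R[i] :=
  [set l | ~ exists V : B * B -> B * B,
    [/\ continuous V, cancel (complexified_sub Q l) V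
      & cancel V (complexified_sub Q l)]].

(* The spectrum is empty only when [B] is the zero space, and the radius is
   then [sup set0 = 0]. *)
Definition spectral_radius (Q : B -> B) : R :=
  sup [set ComplexField.Normc.normc l | l in spectrum Q].

End Operators.

(* Main.v *)
(* Let T = (P - S)_+ and U = P - T. Then 0 <= T <= K and 0 <= U <= S. Expand
   P^n = (T + U)^n into words in T and U.

   A word with at least three letters T is a product of three positive operators
   each dominated by a compact one (up to further factors), hence compact by the
   Aliprantis-Burkinshaw theorem. For the latter, the inner factor maps the unit
   ball into an order interval [0, u] up to a small error, and the outer factor
   is bounded by |A w| <= phi |w| + e |w| for a positive functional phi, so that
   only the total boundedness of M [0, u] for phi |.| is needed, where
   0 <= M <= K with K compact. Here M is approximated by combinations of the
   pieces of K cut out by finite partitions of u and phi, the coefficients being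
   chosen by a martingale-type energy argument on these partitions.

   The words with at most two letters T have total norm O(rho^n) for all
   rho > r(S): for real m > r(S) the resolvent of S exists, is positive for m
   arbitrarily close to r(S) (by descending from large m with the Neumann
   series), and defines an equivalent norm for which U contracts by m. *)

Require Import Defs.
From HB Require Import structures.
From mathcomp Require Import all_boot all_order all_algebra.
From mathcomp Require Import complex.
From mathcomp Require Import all_classical all_reals all_analysis.
From mathcomp Require Import ring lra.

Set Implicit Arguments.
Unset Strict Implicit.
Unset Printing Implicit Defensive.

Import Order.TTheory GRing.Theory Num.Theory.
Import numFieldNormedType.Exports.

Local Open Scope classical_set_scope.
Local Open Scope ring_scope.

(** * Vector lattice identities *)

Section BanachLatticeTheory.
Context {R : realType} {B : banachLatticeType R}.
Implicit Types x y z u v w : B.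

Definition ppart x := bl_join x 0.
Definition modulus x := bl_join x (- x).

Lemma ble_refl x : x <=: x. Proof. exact: bl_le_refl. Qed.
Hint Resolve ble_refl : core.

Lemma ble_trans y x z : x <=: y -> y <=: z -> x <=: z.
Proof. exact: bl_le_trans. Qed.

Lemma ble_anti x y : x <=: y -> y <=: x -> x = y.
Proof. by move=> xy yx; apply: bl_le_anti; rewrite xy. Qed.

Lemma ble_addr x y z : x <=: y -> x + z <=: y + z.
Proof. exact: bl_leD2r. Qed.

Lemma ble_sub0 x y : (0 <=: y - x) = (x <=: y).
Proof.
apply/idP/idP => h.
  by move: (ble_addr x h); rewrite add0r subrK.
by move: (ble_addr (- x) h); rewrite subrr.
Qed.

Lemma ble_add x y u v : x <=: y -> u <=: v -> x + u <=: y + v.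
Proof.
move=> xy uv; apply: (@ble_trans (y + u)); first exact: ble_addr.
by rewrite ![y + _]addrC; exact: ble_addr.
Qed.

Lemma ble_opp x y : (- x <=: - y) = (y <=: x).
Proof. by rewrite -ble_sub0 opprK addrC ble_sub0. Qed.

Lemma ble_subl_addr x y z : (x - y <=: z) = (x <=: z + y).
Proof. by rewrite -ble_sub0 opprB addrA ble_sub0. Qed.

Lemma bl_add_ge0 x y : 0 <=: x -> 0 <=: y -> 0 <=: x + y.
Proof. by move=> x0 y0; rewrite -[0]addr0; exact: ble_add. Qed.

Lemma ble_addl x y : 0 <=: y -> x <=: x + y.
Proof. by move=> y0; rewrite -{1}[x]addr0; apply: ble_add. Qed.

Lemma ble_scale (a : R) x y : 0 <= a -> x <=: y -> a *: x <=: a *: y.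
Proof. exact: bl_leZ. Qed.

Lemma bl_scale_ge0 (a : R) x : 0 <= a -> 0 <=: x -> 0 <=: a *: x.
Proof. by move=> a0 x0; rewrite -(scaler0 _ a); exact: ble_scale. Qed.

Lemma bl_sum_ge0 (I : finType) (r : pred I) (f : I -> B) :
  (forall i, 0 <=: f i) -> 0 <=: \sum_(i | r i) f i.
Proof.
by move=> f0; apply: (@big_ind _ (fun x => 0 <=: x)) => //; exact: bl_add_ge0.
Qed.

Lemma ble_sum_term (I : finType) (f : I -> B) i :
  (forall j, 0 <=: f j) -> f i <=: \sum_j f j.
Proof.
by move=> f0; rewrite (bigD1 i)//=; apply: ble_addl; apply: bl_sum_ge0.
Qed.

Lemma ble_joinl x y : x <=: bl_join x y.
Proof. by have := bl_leUx x y (bl_join x y); rewrite bl_le_refl => /esym/andP[]. Qed.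

Lemma ble_joinr x y : y <=: bl_join x y.
Proof. by have := bl_leUx x y (bl_join x y); rewrite bl_le_refl => /esym/andP[]. Qed.

Lemma bl_join_lub x y z : x <=: z -> y <=: z -> bl_join x y <=: z.
Proof. by move=> xz yz; rewrite bl_leUx xz. Qed.

Lemma bl_join_add x y z : bl_join x y + z = bl_join (x + z) (y + z).
Proof.
apply: ble_anti; last first.
  by apply: bl_join_lub; apply: ble_addr; [exact: ble_joinl|exact: ble_joinr].
rewrite -[z in X in X <=: _]opprK ble_subl_addr.
by apply: bl_join_lub; rewrite -ble_subl_addr opprK; [exact: ble_joinl|exact: ble_joinr].
Qed.

Lemma bl_join_scale (a : R) x y : 0 < a ->
  a *: bl_join x y = bl_join (a *: x) (a *: y).
Proof.
move=> a0; have a0' := ltW a0; apply: ble_anti; last first.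
  by apply: bl_join_lub; apply: ble_scale => //; [exact: ble_joinl|exact: ble_joinr].
have e z : z = a *: (a^-1 *: z) by rewrite scalerA divff ?scale1r// gt_eqF.
rewrite [X in _ <=: X]e; apply: ble_scale => //; apply: bl_join_lub.
  have -> : x = a^-1 *: (a *: x) by rewrite scalerA mulVf ?scale1r// gt_eqF.
  apply: ble_scale; first by rewrite invr_ge0.
  by rewrite -e; exact: ble_joinl.
have -> : y = a^-1 *: (a *: y) by rewrite scalerA mulVf ?scale1r// gt_eqF.
apply: ble_scale; first by rewrite invr_ge0.
by rewrite -e; exact: ble_joinr.
Qed.

Lemma ppart_ge0 x : 0 <=: ppart x. Proof. exact: ble_joinr. Qed.
Lemma ble_ppart x : x <=: ppart x. Proof. exact: ble_joinl. Qed.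
Hint Resolve ppart_ge0 ble_ppart : core.

Lemma ppart_le x y : x <=: y -> 0 <=: y -> ppart x <=: y.
Proof. exact: bl_join_lub. Qed.

Lemma ppart_mono x y : x <=: y -> ppart x <=: ppart y.
Proof. by move=> xy; apply: ppart_le => //; apply: ble_trans xy _. Qed.

Lemma ppart_id x : 0 <=: x -> ppart x = x.
Proof. by move=> x0; apply: ble_anti => //; exact: ppart_le. Qed.

Lemma ppart_sub x : x = ppart x - ppart (- x).
Proof.
apply/eqP; rewrite eq_sym subr_eq addrC; apply/eqP.
by rewrite /ppart bl_join_add addNr add0r; apply: ble_anti; apply: bl_join_lub;
  [exact: ble_joinr|exact: ble_joinl|exact: ble_joinr|exact: ble_joinl].
Qed.

Lemma ppart_add x y : ppart (x + y) <=: ppart x + ppart y.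
Proof. by apply: ppart_le; [exact: ble_add|exact: bl_add_ge0]. Qed.

Lemma ppart_scale (a : R) x : 0 <= a -> ppart (a *: x) = a *: ppart x.
Proof.
rewrite le_eqVlt => /orP[/eqP <-|a0]; first by rewrite !scale0r ppart_id.
by rewrite /ppart bl_join_scale// scaler0.
Qed.

(** The modulus is the join of [2 *: x] and 0, translated by [- x]. *)
Lemma modulusE x : modulus x = ppart x + ppart (- x).
Proof.
have -> : modulus x = bl_join (x + x) 0 - x by rewrite bl_join_add addrK add0r.
have -> : x + x = 2 *: x by rewrite scaler_nat mulr2n.
rewrite -/(ppart _) ppart_scale// scaler_nat mulr2n -addrA; congr (_ + _).
by rewrite {2}(ppart_sub x) opprB addrCA subrr addr0.
Qed.

Lemma modulus_ge0 x : 0 <=: modulus x.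
Proof. by rewrite modulusE bl_add_ge0. Qed.
Hint Resolve modulus_ge0 : core.

Lemma ble_modulus x : x <=: modulus x. Proof. exact: ble_joinl. Qed.
Lemma ble_modulusN x : - x <=: modulus x. Proof. exact: ble_joinr. Qed.

Lemma modulus_le x y : x <=: y -> - x <=: y -> modulus x <=: y.
Proof. exact: bl_join_lub. Qed.

Lemma ppart_le_modulus x : ppart x <=: modulus x.
Proof. by rewrite modulusE ble_addl. Qed.

Lemma modulus_id x : 0 <=: x -> modulus x = x.
Proof.
move=> x0; apply: ble_anti; last exact: ble_modulus.
apply: modulus_le; first exact: ble_refl.
by apply: (@ble_trans 0) => //; rewrite -ble_opp opprK oppr0.
Qed.

Lemma norm_modulus x : `|modulus x| = `|x|.
Proof.
have mm : modulus (modulus x) = modulus x by exact: modulus_id.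
apply/le_anti/andP; split; apply: bl_norm_solid; rewrite -!/(modulus _) mm.
  exact: ble_refl.
exact: ble_refl.
Qed.

Lemma norm_mono x y : 0 <=: x -> x <=: y -> `|x| <= `|y|.
Proof.
move=> x0 xy; apply: bl_norm_solid; rewrite -!/(modulus _) !modulus_id//.
exact: ble_trans xy.
Qed.

Lemma norm_le_modulus x y : modulus x <=: y -> `|x| <= `|y|.
Proof. by move=> xy; rewrite -norm_modulus; exact: norm_mono. Qed.

Lemma norm_ppart x : `|ppart x| <= `|x|.
Proof. by rewrite -(norm_modulus x) norm_mono// ppart_le_modulus. Qed.

Lemma norm_ppart_le x y : x <=: y -> `|ppart x| <= `|ppart y|.
Proof. by move=> xy; rewrite norm_mono// ppart_mono. Qed.

(** Closedness of the positive cone: for positive [y], [ppart (- x)] lies below [ppart (y - x)],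
    whose norm is at most the distance from [x] to [y]. *)
Lemma bl_ge0_closed x :
  (forall e : R, 0 < e -> exists2 y, 0 <=: y & `|x - y| <= e) -> 0 <=: x.
Proof.
move=> h; suff : ppart (- x) = 0.
  by move=> e; rewrite -ble_opp oppr0 -e.
apply/eqP; rewrite -normr_eq0; apply/eqP/le_anti; rewrite normr_ge0 andbT.
apply/ler_addgt0Pl => e /h[y y0 xy]; rewrite addr0; apply: le_trans xy.
rewrite distrC; apply: le_trans (norm_ppart _); apply: norm_ppart_le.
by rewrite addrC ble_addl.
Qed.

Lemma riesz_decomp2 x y z : 0 <=: x -> 0 <=: y -> 0 <=: z -> x <=: y + z ->
  exists2 x1, 0 <=: x1 /\ x1 <=: y & 0 <=: x - x1 /\ x - x1 <=: z.
Proof.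
(* [x - ppart (x - y)] is the meet of [x] and [y]. *)
move=> x0 y0 z0 xyz; exists (x - ppart (x - y)); last first.
  rewrite opprB addrCA subrr addr0; split=> //; apply: ppart_le => //.
  by rewrite ble_subl_addr addrC.
split; last by rewrite ble_subl_addr addrC -ble_subl_addr.
by rewrite ble_sub0; apply: ppart_le => //; rewrite ble_subl_addr ble_addl.
Qed.

Lemma riesz_decomp (I : finType) (u : I -> B) x :
  (forall i, 0 <=: u i) -> 0 <=: x -> x <=: \sum_i u i ->
  exists xs : I -> B, (forall i, 0 <=: xs i /\ xs i <=: u i) /\ x = \sum_i xs i.
Proof.
move=> u0; move: (index_enum I) (index_enum_uniq I) => s us.
suff H : forall x, 0 <=: x -> x <=: \sum_(i <- s) u i ->
  exists xs : I -> B, (forall i, 0 <=: xs i /\ xs i <=: u i) /\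
     x = \sum_(i <- s) xs i by exact: H.
elim: s us => [_|i s IH /= /andP[si us]] {}x x0.
  rewrite big_nil => xle; exists (fun=> 0); split=> //.
  by rewrite big_nil; exact: ble_anti.
rewrite big_cons => xle.
have s0 : 0 <=: \sum_(j <- s) u j.
  by apply: (@big_ind _ (fun x => 0 <=: x)) => //; exact: bl_add_ge0.
have [x1 [x10 x1u] [x20 x2u]] := riesz_decomp2 x0 (u0 i) s0 xle.
have [xs [xsu e]] := IH us _ x20 x2u.
(* Since [i] does not occur in [s], the new value at [i] leaves the sum over [s] unchanged. *)
exists (fun j => if j == i then x1 else xs j); split.
  by move=> j; case: eqVneq => [->|//].
rewrite big_cons eqxx -[LHS](subrK x1) addrC e; congr (_ + _).
rewrite !big_seq; apply: eq_bigr => j js; case: eqVneq => // ji.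
by rewrite -ji js in si.
Qed.

Section PositiveOperators.
Variable Q : {linear B -> B}.
Hypothesis Q0 : positive_operator Q.

Lemma pos_mono x y : x <=: y -> Q x <=: Q y.
Proof. by rewrite -ble_sub0 => /Q0; rewrite linearB ble_sub0. Qed.

Lemma pos_modulus x : modulus (Q x) <=: Q (modulus x).
Proof.
by apply: modulus_le; rewrite -?linearN; apply: pos_mono;
  [exact: ble_modulus|exact: ble_modulusN].
Qed.

Lemma norm_pos_modulus x : `|Q x| <= `|Q (modulus x)|.
Proof. exact/norm_le_modulus/pos_modulus. Qed.

End PositiveOperators.
End BanachLatticeTheory.
#[global] Hint Resolve ble_refl ppart_ge0 ble_ppart modulus_ge0 : core.

(** * Hahn-Banach *)

Section HahnBanach.
Context {R : realType} {V : lmodType R}.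
Implicit Types (p q : V -> R) (x y w : V).

Definition sublinear p :=
  (forall x y, p (x + y) <= p x + p y) /\
  (forall (a : R) x, 0 <= a -> p (a *: x) = a * p x).

Lemma sublinear0 p : sublinear p -> p 0 = 0.
Proof. by case=> _ /(_ 0 0 (lexx 0)); rewrite scale0r mul0r. Qed.

Lemma sublinear_oppr p x : sublinear p -> - p (- x) <= p x.
Proof.
move=> sp; have := sp.1 x (- x); rewrite subrr sublinear0// -lerBlDr sub0r.
by [].
Qed.

Lemma sublinear_pscale p : (forall x y, p (x + y) <= p x + p y) -> p 0 = 0 ->
  (forall (a : R) x, 0 < a -> p (a *: x) <= a * p x) -> sublinear p.
Proof.
move=> pD p0 pZ; split=> // a x; rewrite le_eqVlt => /orP[/eqP <-|a0].
  by rewrite scale0r mul0r.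
apply/le_anti; rewrite pZ//= -ler_pdivlMl//.
rewrite -{1}[x]scale1r -(mulVf (lt0r_neq0 a0)) -scalerA pZ// invr_gt0//.
Qed.

Section tilt.
Variables (p : V -> R) (w : V).
Hypothesis sp : sublinear p.

Let A x := [set p (x + t *: w) - t * p w | t in [set t : R | 0 <= t]].
(** Lowers [p] in the direction [- w], down to at most [- p w] at [- w], so that a linear functional
    below the tilt is forced to be at least [p w] at [w]. *)
Definition tilt x := inf (A x).

Let lbA x (t : R) : 0 <= t -> - p (- x) <= p (x + t *: w) - t * p w.
Proof.
move=> t0; rewrite -(sp.2 _ _ t0) lerBrDl lerBlDr.
by apply: le_trans (sp.1 _ _); rewrite addrAC subrr add0r.
Qed.

Let tilt_lb x t : 0 <= t -> tilt x <= p (x + t *: w) - t * p w.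
Proof.
move=> t0; apply: ge_inf; last by exists t.
by exists (- p (- x)) => _ [s s0 <-]; exact: lbA.
Qed.

Let tilt_glb x (c : R) :
  (forall t : R, 0 <= t -> c <= p (x + t *: w) - t * p w) -> c <= tilt x.
Proof.
move=> h; apply: lb_le_inf; last by move=> _ [t t0 <-]; exact: h.
by exists (p (x + 0 *: w) - 0 * p w); exists 0 => //=.
Qed.

Lemma tilt_le x : tilt x <= p x.
Proof. by have := tilt_lb x (lexx 0); rewrite scale0r addr0 mul0r subr0. Qed.

Lemma tilt_opp : tilt (- w) <= - p w.
Proof.
have := tilt_lb (- w) ler01.
by rewrite scale1r addNr mul1r sublinear0// sub0r.
Qed.

Lemma tilt_shift x : tilt x <= p (x + w) - p w.
Proof. by have := tilt_lb x ler01; rewrite scale1r mul1r. Qed.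

Lemma tilt_sublinear : sublinear tilt.
Proof.
apply: sublinear_pscale => [x y||a x a0].
- rewrite -lerBlDr; apply: tilt_glb => s s0; rewrite lerBlDr -lerBlDl.
  apply: tilt_glb => t t0; rewrite lerBlDl.
  apply: le_trans (tilt_lb _ (addr_ge0 s0 t0)) _.
  have := sp.1 (x + s *: w) (y + t *: w); rewrite addrACA -scalerDl; lra.
- apply/le_anti; rewrite -{1}(sublinear0 sp) tilt_le/=.
  apply: tilt_glb => t t0; apply: le_trans (lbA _ t0).
  by rewrite oppr0 sublinear0// oppr0.
- rewrite -ler_pdivrMl//; apply: tilt_glb => t t0; rewrite ler_pdivrMl//.
  apply: le_trans (tilt_lb _ (mulr_ge0 (ltW a0) t0)) _.
  by rewrite -scalerA -scalerDr sp.2 ?(ltW a0)// -mulrA -mulrBr.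
Qed.

End tilt.

Let below p := {q : V -> R | sublinear q /\ forall x, q x <= p x}.
Let belowR p (q1 q2 : below p) := `[< forall x, sval q2 x <= sval q1 x >].

(* Zorn on total sublinear functions instead of partial linear extensions: a
   minimal sublinear function [q] is linear because it equals its own tilts
   [x |-> inf_(t >= 0) q (x + t w) - t q w]. *)
Lemma minimal_sublinear p : sublinear p -> exists q, [/\ sublinear q,
  forall x, q x <= p x &
  forall q', sublinear q' -> (forall x, q' x <= q x) -> forall x, q x <= q' x].
Proof.
move=> sp.
have p0 : below p by exists p.
have [| | |[q [sq qp]] qmin] := @ZL_preorder _ p0 (@belowR p).
- by move=> q; apply/asboolP.
- move=> q1 q2 q3 /asboolP h1 /asboolP h2; apply/asboolP => x.
  exact: le_trans (h1 x).
- move=> A totA; have [[a Aa]|A0] := pselect (exists a, A a); last first.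
    by exists p0 => s As; case: A0; exists s.
  pose F x := [set sval s x | s in A].
  have lb x : has_lbound (F x).
    exists (- p (- x)) => _ [s As <-]; have [ss sp'] := svalP s.
    by apply: le_trans (sublinear_oppr _ ss); rewrite lerN2.
  have glb x c : (forall s, A s -> c <= sval s x) -> c <= inf (F x).
    move=> h; apply: lb_le_inf; first by exists (sval a x), a.
    by move=> _ [s As <-]; exact: h.
  have ilb x s : A s -> inf (F x) <= sval s x.
    by move=> As; apply: ge_inf => //; exists s.
  have sF : sublinear (fun x => inf (F x)).
    apply: sublinear_pscale => [x y||c x c0].
    + rewrite -lerBlDr; apply: (glb _ _) => s As; rewrite lerBlDr -lerBlDl.
      apply: (glb _ _) => t At; rewrite lerBlDl.
      (* In a chain the smaller of [s] and [t] serves for both terms, which makes the pointwise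
         infimum subadditive. *)
      have [/asboolP h|/asboolP h] := totA s t As At.
        apply: le_trans (ilb _ _ At) _; apply: le_trans ((svalP t).1.1 _ _) _.
        by rewrite lerD2r.
      apply: le_trans (ilb _ _ As) _; apply: le_trans ((svalP s).1.1 _ _) _.
      by rewrite lerD2l.
    + apply/le_anti; rewrite -{1}(sublinear0 (svalP a).1) ilb//=.
      by apply: (glb _ _) => s As; rewrite (sublinear0 (svalP s).1).
    + rewrite -ler_pdivrMl//; apply: (glb _ _) => s As; rewrite ler_pdivrMl//.
      by apply: le_trans (ilb _ _ As) _; rewrite (svalP s).1.2// ltW.
  have Fp x : inf (F x) <= p x by apply: le_trans (ilb _ _ Aa) ((svalP a).2 x).
  exists (exist (fun q => sublinear q /\ forall x, q x <= p x) _ (conj sF Fp)).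
  by move=> s As; apply/asboolP => x /=; exact: ilb.
- exists q; split=> // q' sq' q'q x.
  have q'p y : q' y <= p y by apply: le_trans (q'q y) (qp y).
  have := qmin (exist (fun q => sublinear q /\ forall x, q x <= p x) q'
    (conj sq' q'p)).
  rewrite /belowR.
  by move=> /(_ (introT (asboolP _) q'q))/asboolP/(_ x).
Qed.

Lemma hahn_banach_support p w : sublinear p ->
  exists f : {scalar V}, (forall x, f x <= p x) /\ f w = p w.
Proof.
move=> sp; have [q [sq qp qmin]] := minimal_sublinear (tilt_sublinear w sp).
have qD x y : q (x + y) = q x + q y.
  apply/le_anti; rewrite sq.1/= -lerBrDr.
  (* Minimality puts [q] below its own tilt along [y], which gives superadditivity. *)
  apply: le_trans (qmin _ (tilt_sublinear y sq) (tilt_le y sq) x) _.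
  exact: tilt_shift.
have qN x : q (- x) = - q x.
  by apply/eqP; rewrite -addr_eq0 -qD addNr sublinear0.
have lq : scalable_for *%R q.
  move=> a x; have [a0|/ltW a0] := leP 0 a; first exact: sq.2.
  by rewrite -[a in LHS]opprK scaleNr qN sq.2 ?oppr_ge0// mulNr opprK.
have lq' : GRing.linear_for *%R q by move=> a x y; rewrite qD lq.
pose f : {scalar V} := HB.pack q (GRing.isLinear.Build _ _ _ _ q lq').
exists f; split=> [x|]; first by apply: le_trans (qp x) _; exact: tilt_le.
apply/le_anti/andP; split; first by apply: le_trans (qp w) _; exact: tilt_le.
rewrite -lerN2 -qN; apply: le_trans (qp _) _; exact: tilt_opp.
Qed.

End HahnBanach.

(** * Boundedness and compactness *)

Section PositiveBounded.
Context {R : realType} {B : banachLatticeType R}.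

(** If no bound exists, there are positive [y n] of norm [(1 / 2) ^+ n] with [|Q (y n)| >= n]. Their
    sum [s] dominates each of them, so [|Q s|] is at least every integer. *)
Lemma pos_bounded (Q : {linear B -> B}) : positive_operator Q ->
  exists2 C : R, 0 <= C & forall x, `|Q x| <= C * `|x|.
Proof.
move=> Q0; apply: contrapT => nb.
have unb (n : nat) : exists y : B,
    [/\ 0 <=: y, `|y| = (1 / 2) ^+ n & n%:R <= `|Q y|].
  have [C0 CE] : 0 <= n%:R * 2 ^+ n :> R /\ n%:R * 2 ^+ n * (1 / 2) ^+ n = n%:R :> R.
    split; first by rewrite mulr_ge0// exprn_ge0.
    by rewrite -mulrA -exprMn mul1r divff ?pnatr_eq0// expr1n mulr1.
  have [x xC] : exists x, n%:R * 2 ^+ n * `|x| < `|Q x|.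
    apply: contrapT => h; apply: nb; exists (n%:R * 2 ^+ n) => // x.
    by rewrite leNgt; apply/negP => ?; apply: h; exists x.
  have x0 : 0 < `|modulus x|.
    rewrite norm_modulus normr_gt0; apply: contraTneq xC => ->.
    by rewrite linear0 !normr0 mulr0 ltxx.
  have a0 : 0 <= (1 / 2) ^+ n / `|modulus x| by rewrite divr_ge0// exprn_ge0.
  exists (((1 / 2) ^+ n / `|modulus x|) *: modulus x); split.
  - exact: bl_scale_ge0.
  - by rewrite normrZ ger0_norm// divfK// gt_eqF.
  - rewrite linearZ/= normrZ ger0_norm// -[leLHS]CE [leLHS]mulrC -[leRHS]mulrA.
    rewrite ler_pM2l ?exprn_gt0// ler_pdivlMl// mulrC norm_modulus.
    exact: le_trans (ltW xC) (norm_pos_modulus Q0 x).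
have /choice[y yP] := unb.
have : cvgn (series y).
  apply: normed_cvg.
  have -> : [normed series y] = series (geometric 1 (1 / 2)).
    apply/funext => n; rewrite /series/=; apply: eq_bigr => i _.
    by rewrite /geometric mul1r; have [_ -> _] := yP i.
  by apply: is_cvg_geometric_series; rewrite ger0_norm; lra.
set s := limn (series y) => /cvgrPdist_le sy.
have ys n : y n <=: s.
  rewrite -ble_sub0; apply: bl_ge0_closed => e /sy[N _ hN].
  (* The partial sum reaches past [n], so that [y n] is one of its terms. *)
  exists (series y (maxn N n.+1) - y n); last first.
    by rewrite opprB addrA subrK; apply: hN => /=; rewrite leq_maxl.
  rewrite ble_sub0 /series/= (bigD1_seq n) ?iota_uniq//=; last first.
    by rewrite mem_index_iota leq_maxr.
  apply: ble_addl; apply: (@big_ind _ (fun x => 0 <=: x)) => //.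
    exact: bl_add_ge0.
  by move=> i _; have [] := yP i.
have := archi_boundP (normr_ge0 (Q s)).
set n := Num.bound _; rewrite ltNge => /negP; apply.
have [y0 _ /le_trans] := yP n; apply.
by apply: norm_mono; [exact: Q0|exact: pos_mono].
Qed.

Lemma positive_le_pos (P Q : {linear B -> B}) : positive_le P Q -> 
  positive_operator P /\ positive_operator Q.
Proof.
by move=> h; split=> f /h[] // p0 pq; apply: ble_trans pq.
Qed.

End PositiveBounded.

(** * Total boundedness by finite colourings *)

Section FiniteColorings.
Context {R : realType}.

(* Total boundedness by finite colourings rather than nets, so that it can be
   pulled back along arbitrary maps. *)
Definition tbounded (X : Type) (D : set X) (d : X -> X -> R) :=
  forall e : R, 0 < e -> exists (I : finType) (c : X -> I),
    forall x y, D x -> D y -> c x = c y -> d x y <= e.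

(** Turns a colouring into a finite net inside [D]: one representative for each colour met by [D],
    the default [x0] for the others. *)
Lemma color_rep (X : Type) (D : set X) (I : finType) (c : X -> I) (x0 : X) :
  D x0 -> exists r : I -> X,
    (forall i, D (r i)) /\ forall x, D x -> c (r (c x)) = c x.
Proof.
move=> Dx0.
have /choice[r rP] i : exists x, D x /\
    ((exists y, D y /\ c y = i) -> c x = i).
  have [[y [Dy cy]]|h] := pselect (exists y, D y /\ c y = i).
    by exists y; split.
  by exists x0; split.
exists r; split=> [i|x Dx]; first by have [] := rP i.
by have [_ ->] := rP (c x) => //; exists x.
Qed.

Lemma tbounded_interval (C : R) :
  tbounded [set t : R | `|t| <= C] (fun s t => `|s - t|).
Proof.
move=> e e0; pose N := Num.truncn ((C + C) / e).
exists 'I_N.+1, (fun t => inord (Num.truncn ((t + C) / e))) => s t /= sC tC.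
move=> /(congr1 val); rewrite /=.
have H (r : R) : `|r| <= C -> 0 <= (r + C) / e /\ (Num.truncn ((r + C) / e) < N.+1)%N.
  rewrite ler_norml => /andP[r1 r2]; split; first by rewrite divr_ge0 ?(ltW e0)//; lra.
  by rewrite ltnS /N; apply: le_truncn; rewrite ler_pM2r ?invr_gt0//; lra.
have [s0 sN] := H _ sC; have [t0 tN] := H _ tC.
rewrite !inordK// => st.
have /andP[s1 s2] := truncn_itv s0; have /andP[t1 t2] := truncn_itv t0.
rewrite -st in t1 t2.
have se : s + C = (s + C) / e * e by rewrite divfK// gt_eqF.
have te : t + C = (t + C) / e * e by rewrite divfK// gt_eqF.
have -> : s - t = ((s + C) / e - (t + C) / e) * e by rewrite mulrBl -se -te; lra.
rewrite normrM (gtr0_norm e0) -[leRHS]mul1r ler_pM2r// ler_norml.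
by rewrite -natr1 in s2 t2; apply/andP; split; lra.
Qed.

End FiniteColorings.

Section CompactColorings.
Context {R : realType} {B : completeNormedModType R}.

Lemma precompact_tbounded (X : Type) (f : X -> B) (D : set X) :
  precompact (f @` D) -> tbounded D (fun x y => `|f x - f y|).
Proof.
rewrite precompactE compact_cover => cpt e e0.
have [|z zc|F _ cov] := cpt B (closure (f @` D)) (fun z => ball z (e / 2)).
- by move=> z _; apply: ball_open; rewrite divr_gt0.
- by exists z => //; apply: ballxx; rewrite divr_gt0.
(* The colour of [x] is the index of the first centre within [e / 2] of [f x]; the extra ordinal is
   the value of [find] when there is none. *)
pose s : seq B := finmap.enum_fset F.
pose a x := fun z : B => `[< ball z (e / 2) (f x) >].
exists 'I_(size s).+1, (fun x => inord (find (a x) s)) => x y Dx Dy.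
have H t : D t -> ball (nth 0 s (find (a t) s)) (e / 2) (f t).
  move=> Dt; have [z /= zF zt] := cov (f t) (subset_closure (imageP f Dt)).
  have := @nth_find _ 0 (a t) s => /(_ _)/asboolP; apply.
  by apply/hasP; exists z => //; exact/asboolP.
move=> /(congr1 val); rewrite /= !inordK ?ltnS ?find_size// => xy.
have wx := H _ Dx; have wy := H _ Dy; rewrite -xy in wy.
have := ball_triangle (ball_sym wx) wy.
by rewrite -splitr -ball_normE/= => /ltW.
Qed.

(** At every scale an ultrafilter on the closure contains one of the finitely many colour cells,
    thickened because the filter lives only on the closure; hence it is Cauchy. *)
Lemma tbounded_precompact (X : Type) (f : X -> B) (D : set X) :
  tbounded D (fun x y => `|f x - f y|) -> precompact (f @` D).
Proof.
move=> tb; rewrite precompactE compact_ultra => F UF FD.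
have PF : ProperFilter F by exact: ultra_proper.
have : cauchy F.
  apply: cauchy_exP => e e0.
  have e4 : 0 < e / 4 by rewrite divr_gt0.
  have [I [c cP]] := tb _ e4.
  pose Z i := [set z | exists x, [/\ D x, c x = i & `|z - f x| <= e / 4]].
  have [i Fi] : exists i, F (Z i).
    apply: contrapT => h.
    have /filter_forall : forall i, F (~` Z i).
      move=> i; have [Fi|//] := in_ultra_setVsetC (Z i) UF.
      by case: h; exists i.
    move=> /(filterI FD)/filter_ex[z [zD zZ]].
    have [_ [[x Dx <-]]] := zD _ (nbhsx_ballx z (e / 4) e4).
    rewrite -ball_normE/= => /ltW zx; apply: (zZ (c x)); exists x; split=> //.
  have [z0 [x0 [Dx0 c0 zx0]]] := filter_ex Fi.
  exists z0; apply: filterS Fi => z [x [Dx cx zx]].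
  rewrite -ball_normE/=.
  have := cP x0 x Dx0 Dx; rewrite c0 cx => /(_ erefl) xx.
  have -> : z0 - z = (z0 - f x0) + (f x0 - f x) - (z - f x).
    by rewrite opprB !addrA !subrK.
  apply: le_lt_trans (ler_normB _ _) _.
  apply: (@le_lt_trans _ _ (e / 4 + e / 4 + e / 4)); last lra.
  apply: lerD => //; apply: le_trans (ler_normD _ _) _; exact: lerD.
move=> /cauchy_cvg; move: (lim F) => p Fp; exists p; split=> //.
have cl : closed (closure (f @` D)) by exact: closed_closure.
apply: cl => U /Fp FU; exact: filter_ex (filterI FD FU).
Qed.

End CompactColorings.

(** * Products of operators dominated by compact ones *)

(** Cauchy-Schwarz with its defect: the full gap is the sum over [i] of [t i] times the squared
    deviation of [s i / t i] from the mean ratio, and only the term [k] is kept. Where [t i]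
    vanishes so does [s i], in agreement with division by 0 giving 0. *)
Lemma sum_sqr_div_ge (R : realType) (T : finType) (s t : T -> R) (k : T) :
  (forall i, 0 <= s i /\ s i <= t i) ->
  (\sum_i s i) ^+ 2 / (\sum_i t i) +
     t k * (s k / t k - (\sum_i s i) / (\sum_i t i)) ^+ 2 <=
  \sum_i s i ^+ 2 / t i.
Proof.
move=> st; set S := \sum_i s i; set T' := \sum_i t i; pose c := S / T'.
have t0 i : 0 <= t i by have [s0 /(le_trans s0)] := st i.
have E i : s i ^+ 2 / t i = (2 * c * s i - c ^+ 2 * t i) + t i * (s i / t i - c) ^+ 2.
  have [ti|ti] := eqVneq (t i) 0; last by field.
  have -> : s i = 0.
    by apply/le_anti; have [-> sit] := st i; rewrite andbT -ti.
  by rewrite ti; ring.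
have ES : S ^+ 2 / T' = 2 * c * S - c ^+ 2 * T'.
  rewrite /c; have [T0|T0] := eqVneq T' 0; last by field.
  have -> : S = 0.
    apply/le_anti; rewrite sumr_ge0 ?andbT; last by move=> i _; have [] := st i.
    by rewrite -T0; apply: ler_sum => i _; have [] := st i.
  by rewrite T0; ring.
rewrite ES -/c (eq_bigr _ (fun i _ => E i)) big_split/= sumrB -!mulr_sumr.
rewrite lerD2l (bigD1 k)//= lerDl sumr_ge0// => i _.
by rewrite mulr_ge0// sqr_ge0.
Qed.

(** For nonzero [t] and [d = s / t - c] the left side is [t * |d|], and [|d| <= k + d ^+ 2 / k]
    follows from [(k - |d|) ^+ 2 >= 0]. *)
Lemma dist_mul_le_sqr (R : realType) (s t c k : R) : 0 <= s -> s <= t -> 0 < k ->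
  `|s - c * t| <= k * t + t * (s / t - c) ^+ 2 / k.
Proof.
move=> s0 st k0; have [t0|t0] := eqVneq t 0.
  have -> : s = 0 by apply/le_anti; rewrite s0 andbT -t0.
  by rewrite t0 !mulr0 mul0r subr0 normr0 !mul0r addr0.
have tp : 0 < t by rewrite lt0r t0 (le_trans s0).
set d := s / t - c; have -> : s - c * t = t * d by rewrite /d; field.
rewrite normrM gtr0_norm// [k * t]mulrC -mulrA -mulrDr ler_pM2l//.
rewrite -[d ^+ 2]real_normK ?num_real//.
set a := `|d|; have a0 : 0 <= a by exact: normr_ge0.
have : 0 <= (k - a) ^+ 2 / k by rewrite divr_ge0 ?sqr_ge0// ltW.
have -> : (k - a) ^+ 2 / k = k - 2 * a + a ^+ 2 / k by field; rewrite gt_eqF.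
by lra.
Qed.

(** * Positive functionals *)

Section Functionals.
Context {R : realType} {B : banachLatticeType R}.
Implicit Types (f g : {scalar B}) (x y w : B).

Definition positive_functional f := forall x, 0 <=: x -> 0 <= f x.

Definition functional_le f g := forall x, 0 <=: x -> 0 <= f x /\ f x <= g x.

Lemma functional_mono f x y : positive_functional f -> x <=: y -> f x <= f y.
Proof. by move=> f0; rewrite -ble_sub0 => /f0; rewrite linearB subr_ge0. Qed.

Lemma functional_modulus f g x : functional_le f g -> `|f x| <= g (modulus x).
Proof.
move=> fg; have f0 : positive_functional f by move=> y /fg[].
apply: (@le_trans _ _ (f (modulus x))); last by have [] := fg _ (modulus_ge0 x).
rewrite ler_norml -linearN !functional_mono//; first exact: ble_modulus.
by rewrite -ble_opp opprK; exact: ble_modulusN.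
Qed.

(** The conclusion [functional_le f f] encodes positivity of [f], which comes from
    [f (- x) <= p (- x) = 0]. *)
Lemma dominated_functional (p : B -> R) f : (forall x, 0 <=: x -> p (- x) = 0) ->
  (forall x, f x <= p x) -> functional_le f f.
Proof.
move=> p0 fp x x0; split=> //; rewrite -oppr_le0 -linearN.
by apply: le_trans (fp _) _; rewrite p0.
Qed.

Lemma ppart_opp0 x : 0 <=: x -> ppart (- x) = 0.
Proof.
move=> x0; apply: ble_anti => //; apply: ppart_le => //.
by rewrite -ble_opp opprK oppr0.
Qed.

(** Hahn-Banach for the norm of the positive part, rather than the norm, makes the functional
    positive as well as of norm at most 1. *)
Lemma norming_functional w : 0 <=: w -> exists f,
  (forall x, f x <= `|ppart x|) /\ f w = `|w|.
Proof.
move=> w0; have sp : sublinear (fun x : B => `|ppart x|).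
  split=> [x y|a x a0]; last by rewrite ppart_scale// normrZ ger0_norm.
  by apply: le_trans (ler_normD _ _); apply: norm_mono => //; exact: ppart_add.
have [f [fp fw]] := hahn_banach_support w sp.
by exists f; split=> //; rewrite fw ppart_id.
Qed.

(** Supports the sublinear [x |-> f (ppart x)] at [w]; [g] acts as [f] restricted to where [w] is
    positive. *)
Lemma ppart_functional f w : positive_functional f ->
  exists2 g, functional_le g f & g w = f (ppart w).
Proof.
move=> f0; have sp : sublinear (fun x : B => f (ppart x)).
  split=> [x y|a x a0]; last by rewrite ppart_scale// linearZ.
  by rewrite -linearD functional_mono//; exact: ppart_add.
have [g [gp gw]] := hahn_banach_support w sp.
exists g => // x x0; split; last by rewrite -{2}(ppart_id x0).
have [] // := dominated_functional _ gp x0.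
by move=> y y0; rewrite ppart_opp0// linear0.
Qed.

Lemma norm_functional f x : (forall y, f y <= `|ppart y|) -> `|f x| <= `|x|.
Proof.
move=> fp; rewrite ler_norml; apply/andP; split; last first.
  exact: le_trans (fp _) (norm_ppart _).
by rewrite lerNl -linearN -(normrN x); exact: le_trans (fp _) (norm_ppart _).
Qed.

End Functionals.

Section Domination.
Context {R : realType} {B : banachLatticeType R}.
Implicit Types (A D M K : {linear B -> B}) (u x y z w : B).

Let ball1 : set B := [set x | `|x| <= 1].

Lemma tbounded_ball_scale K (C : R) :
  tbounded ball1 (fun x y => `|K x - K y|) ->
  tbounded [set x | `|x| <= C] (fun x y => `|K x - K y|).
Proof.
move=> tb e e0; pose C' := `|C| + 1.
have C0 : 0 < C' by rewrite ltr_pwDr.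
have [|I [c cP]] := tb (e / C'); first by rewrite divr_gt0.
exists I, (fun x => c (C'^-1 *: x)) => x y /= xC yC cxy.
have H z : `|z| <= C -> ball1 (C'^-1 *: z).
  move=> zC; rewrite /ball1/= normrZ gtr0_norm ?invr_gt0// mulrC ler_pdivrMr// mul1r.
  by apply: le_trans zC _; rewrite /C'; apply: le_trans (ler_norm _) _; rewrite lerDl.
have := cP _ _ (H x xC) (H y yC) cxy.
rewrite -linearB -scalerBr linearZ/= normrZ gtr0_norm ?invr_gt0//.
by rewrite linearB mulrC ler_pM2r ?invr_gt0.
Qed.

Let ball10 : ball1 0.
Proof. by rewrite /ball1/= normr0 ler01. Qed.

(** [u] is the sum of the moduli of a finite net of the image under [K]. As [D x <=: K x], the
    excess of [D x] over [u] is at most that of [K x] over a net point within [e]. *)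
Lemma dominated_order_bounded D K : positive_le D K ->
  tbounded ball1 (fun x y => `|K x - K y|) ->
  forall e : R, 0 < e -> exists2 u, 0 <=: u &
    forall x, 0 <=: x -> `|x| <= 1 -> `|ppart (D x - u)| <= e.
Proof.
move=> DK tb e e0; have [I [c cP]] := tb _ e0.
have [r [rb rc]] := color_rep c ball10.
exists (\sum_i modulus (K (r i))); first by apply: bl_sum_ge0 => i.
move=> x x0 x1; apply: le_trans (cP x (r (c x)) x1 (rb _) _); last by rewrite rc.
apply: le_trans (norm_ppart _); apply: norm_ppart_le.
apply: ble_add; first by have [] := DK _ x0.
rewrite ble_opp; apply: ble_trans (ble_modulus _) _.
exact: (@ble_sum_term _ _ _ (fun i => modulus (K (r i)))).
Qed.

(* The dual form of [dominated_order_bounded]; [f] is a finite sum of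
   functionals [g \o K], [g] running through a net of the positive dual ball
   seen on a net of the image of the unit ball under [K]. *)
Lemma dominated_dual_bounded A K : positive_le A K ->
  tbounded ball1 (fun x y => `|K x - K y|) ->
  forall e : R, 0 < e -> exists f : {scalar B},
    [/\ positive_functional f, exists2 C : R, 0 <= C & forall x, `|f x| <= C * `|x| &
      forall w, 0 <=: w -> `|A w| <= f w + e * `|w|].
Proof.
move=> AK tb e e0; have e3 : 0 < e / 3 by rewrite divr_gt0.
have [A0 K0] := positive_le_pos AK.
have [C C0 KC] := pos_bounded K0.
have [I [c cP]] := tb _ e3; have [r [rb rc]] := color_rep c ball10.
have [J [d dP]] := tbounded_interval C e3.
pose D : set {scalar B} := [set f | forall x, f x <= `|ppart x|].
have [f0 [Df0 _]] := @norming_functional _ B 0 (ble_refl 0).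
(* Functionals in [D] are coloured by their values, up to [e / 3], on the finite net [K (r i)]. *)
pose dd (f : {scalar B}) := [ffun i => d (f (K (r i)))].
have [g [gD gc]] := @color_rep _ D _ dd f0 Df0.
have gpos j : positive_functional (g j).
  by move=> x /(dominated_functional _ (gD j))[] // y /ppart_opp0 ->; rewrite normr0.
pose h x := \sum_j g j (K x).
have hl : GRing.linear_for *%R h.
  move=> a x y; rewrite /h mulr_sumr -big_split/=; apply: eq_bigr => j _.
  by rewrite linearP linearP.
pose f : {scalar B} := HB.pack h (GRing.isLinear.Build _ _ _ _ h hl).
exists f; split.
- by move=> x x0; apply: sumr_ge0 => j _; apply: gpos; exact: K0.
- exists (#|{ffun I -> J}|%:R * C); first by rewrite mulr_ge0.
  move=> x; apply: le_trans (ler_norm_sum _ _ _) _.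
  rewrite -mulrA mulr_natl -sumr_const; apply: ler_sum => j _.
  by apply: le_trans (KC x); apply: norm_functional; exact: gD.
move=> w w0; have [->|wn0] := eqVneq w 0.
  by rewrite !linear0 normr0 mulr0 addr0.
have [b [bD bw]] := norming_functional (A0 _ w0).
have wp : 0 < `|w| by rewrite normr_gt0.
pose w1 := `|w|^-1 *: w.
have w1b : ball1 w1 by rewrite /ball1/= normrZ normfV normr_id mulVf// gt_eqF.
have w10 : 0 <=: w1 by rewrite bl_scale_ge0// invr_ge0.
have ww1 : w = `|w| *: w1 by rewrite scalerA mulfV ?scale1r// gt_eqF.
suff H : `|A w1| <= f w1 + e.
  have -> : A w = `|w| *: A w1 by rewrite {1}ww1 linearZ.
  have -> : f w = `|w| * f w1 by rewrite {1}ww1 linearZ.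
  by rewrite normrZ normr_id [e * _]mulrC -mulrDr ler_pM2l.
have <- : b (A w1) = `|A w1|.
  by rewrite /w1 !linearZ/= bw normrZ normfV normr_id.
have bpos : positive_functional b.
  by move=> x /(dominated_functional _ bD)[] // y /ppart_opp0 ->; rewrite normr0.
apply: (@le_trans _ _ (b (K w1))).
  by apply: functional_mono => //; have [] := AK _ w10.
(* [b] and [g j] are compared at [K w1] through the net point [K w2], with three errors of
   [e / 3]. *)
pose j := dd b; pose w2 := r (c w1).
have w12 : `|K w1 - K w2| <= e / 3 by apply: cP => //; [exact: rb|rewrite /w2 rc].
have bj : `|b (K w2) - g j (K w2)| <= e / 3.
  have KC2 : `|K w2| <= C.
    by apply: le_trans (KC _) _; rewrite -[leRHS]mulr1 ler_wpM2l//; exact: rb.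
  apply: dP.
  - by rewrite /=; apply: le_trans KC2; exact: norm_functional.
  - by rewrite /=; apply: le_trans KC2; apply: norm_functional; exact: gD.
  - by have := gc b bD => /ffunP/(_ (c w1)); rewrite !ffunE => ->.
have b1 : `|b (K w1 - K w2)| <= e / 3 by apply: le_trans (norm_functional _ bD) w12.
have g1 : `|g j (K w1 - K w2)| <= e / 3.
  by apply: le_trans (norm_functional _ (gD j)) w12.
have gf : g j (K w1) <= f w1.
  rewrite /f/= /h (bigD1 j)//= lerDl sumr_ge0// => k _.
  by apply: gpos; exact: K0.
move: b1 g1 bj; rewrite !linearB !ler_norml => /andP[_ b1] /andP[g1 _] /andP[_ b2].
lra.
Qed.

(** * Energy of partitions and approximation of dominated operators *)

Section Energy.
Variables (M K : {linear B -> B}) (u : B) (phi : {scalar B}).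
Hypotheses (MK : positive_le M K) (u0 : 0 <=: u).
Hypothesis phi0 : positive_functional phi.

Let K0 : positive_operator K. Proof. by have [] := positive_le_pos MK. Qed.

(* With [s_ij = fs_j (M us_i)] and [t_ij = fs_j (K us_i)], the ratios
   [s_ij / t_ij] play the role of the conditional expectations of the density of
   [M] with respect to [K], and [energy] of their squared [L^2] norm. *)
Definition energy (I J : finType) (us : I -> B) (fs : J -> {scalar B}) : R :=
  \sum_i \sum_j fs j (M (us i)) ^+ 2 / fs j (K (us i)).

Definition partition_of (I J : finType) (us : I -> B) (fs : J -> {scalar B}) :=
  [/\ forall i, 0 <=: us i, u = \sum_i us i,
      forall j, positive_functional (fs j) & forall x, phi x = \sum_j fs j x].

Lemma partition_mass (I J : finType) (us : I -> B) (fs : J -> {scalar B}) :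
  partition_of us fs -> \sum_i \sum_j fs j (K (us i)) = phi (K u).
Proof.
move=> [_ uE _ fE]; under eq_bigr do rewrite -fE.
by rewrite -!linear_sum -uE.
Qed.

Lemma energy_le (I J : finType) (us : I -> B) (fs : J -> {scalar B}) :
  partition_of us fs -> energy us fs <= phi (K u).
Proof.
move=> p; rewrite -(partition_mass p); have [us0 _ fs0 _] := p.
apply: ler_sum => i _; apply: ler_sum => j _.
have [Mi mk] := MK (us0 i); have m0 := fs0 j _ Mi; have := functional_mono (fs0 j) mk.
move: m0; set m := fs j _; set k := fs j _ => m0 mk'.
have [->|k0] := eqVneq k 0; first by rewrite invr0 mulr0.
have kp : 0 < k by rewrite lt0r k0 (le_trans m0).
by rewrite ler_pdivrMr// expr2 ler_pM.
Qed.

Section Refinement.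
Variables (I J : finType) (us : I -> B) (fs : J -> {scalar B}).
Variables (xs : I -> B) (gs : J -> {scalar B}).
Hypotheses (p : partition_of us fs) (xu : forall i, 0 <=: xs i /\ xs i <=: us i).
Hypothesis gf : forall j, functional_le (gs j) (fs j).

Let us' (k : I * bool) := if k.2 then xs k.1 else us k.1 - xs k.1.
Let fs' (k : J * bool) : {scalar B} :=
  if k.2 then gs k.1 else (fs k.1 \- gs k.1 : {scalar B}).

Lemma refine_partition : partition_of us' fs'.
Proof.
have [us0 uE fs0 fE] := p; split.
- move=> [i []] /=; first by have [] := xu i.
  by rewrite ble_sub0; have [] := xu i.
- rewrite (reindex (fun k : I * bool => k))/=; last by exists id.
  rewrite -(pair_bigA _ (fun i b => us' (i, b)))/= uE; apply: eq_bigr => i _.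
  by rewrite big_bool/= addrC subrK.
- move=> [j []] x x0 /=; first by have [] := gf j x0.
  by rewrite /fs'/= subr_ge0; have [] := gf j x0.
- move=> x; rewrite -(pair_bigA _ (fun j b => fs' (j, b) x))/= fE.
  by apply: eq_bigr => j _; rewrite big_bool/= addrC subrK.
Qed.

Let c i j := fs j (M (us i)) / fs j (K (us i)).

(** For each [i], [j] the four subpieces enter [sum_sqr_div_ge], and the square kept is that of the
    subpiece cut out by [xs i] and [gs j]. *)
Lemma energy_refine : energy us fs + \sum_i \sum_j gs j (K (xs i)) *
    (gs j (M (xs i)) / gs j (K (xs i)) - c i j) ^+ 2 <= energy us' fs'.
Proof.
have p' := refine_partition; have [us0 _ fs0 _] := p'.
rewrite /energy -big_split/= -(pair_bigA _ (fun i b =>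
   \sum_k fs' k (M (us' (i, b))) ^+ 2 / fs' k (K (us' (i, b)))))/=.
apply: ler_sum => i _; rewrite -big_split/=.
under [leRHS]eq_bigr => b _ do rewrite -(pair_bigA _ (fun j b' =>
   fs' (j, b') (M (us' (i, b))) ^+ 2 / fs' (j, b') (K (us' (i, b)))))/=.
rewrite exchange_big/=; apply: ler_sum => j _.
have := @sum_sqr_div_ge R (bool * bool)%type
  (fun k => fs' (j, k.2) (M (us' (i, k.1))))
  (fun k => fs' (j, k.2) (K (us' (i, k.1)))) (true, true).
rewrite -!(pair_bigA _ (fun b b' => fs' (j, b') (M (us' (i, b)))))/=.
rewrite -!(pair_bigA _ (fun b b' => fs' (j, b') (K (us' (i, b)))))/=.
rewrite -!(pair_bigA _ (fun b b' => fs' (j, b') (M (us' (i, b))) ^+ 2 /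
   fs' (j, b') (K (us' (i, b)))))/=.
have H (Q : {linear B -> B}) : \sum_b \sum_b' fs' (j, b') (Q (us' (i, b))) =
    fs j (Q (us i)).
  by rewrite !big_bool/= /fs' /us'/= !linearB/=; lra.
rewrite !H; apply => -[b b'] /=.
have [m0 mk] := MK (us0 (i, b)).
by split; [exact: (fs0 (j, b'))|apply: functional_mono (fs0 (j, b')) mk].
Qed.

End Refinement.

(* Pythagoras for martingales: once a partition has almost maximal energy, any
   further refinement, in particular the one cut out by [xs] and [gs], moves the
   ratios [c] by little in [L^2]. *)
Lemma bilinear_approx (e : R) : 0 < e ->
  exists (I J : finType) (us : I -> B) (fs : J -> {scalar B}) (c : I -> J -> R),
    [/\ partition_of us fs, forall i j, 0 <= c i j <= 1 &
    forall (xs : I -> B) (gs : J -> {scalar B}),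
      (forall i, 0 <=: xs i /\ xs i <=: us i) ->
      (forall j, functional_le (gs j) (fs j)) ->
      `|\sum_i \sum_j (gs j (M (xs i)) - c i j * gs j (K (xs i)))| <= e].
Proof.
move=> e0; pose m := phi (K u) + 1.
have m0 : 0 < m by rewrite ltr_wpDl// phi0//; exact: K0 _ u0.
(* [dist_mul_le_sqr] sums to [k] times a mass at most [m], plus the energy gap over [k]; with this
   [k] and a gap at most [k * (e / 2)] each part is at most [e / 2]. *)
pose k := e / 2 / m; have k0 : 0 < k by rewrite !divr_gt0.
have eta0 : 0 < k * (e / 2) by rewrite mulr_gt0// divr_gt0.
pose En := [set t | exists (I J : finType) (us : I -> B) (fs : J -> {scalar B}),
  partition_of us fs /\ t = energy us fs].
have hs : has_sup En.
  split; last by exists (phi (K u)) => _ [I [J [us [fs [p ->]]]]]; exact: energy_le.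
  exists (energy (fun _ : unit => u) (fun _ : unit => phi)), unit, unit.
  exists (fun=> u), (fun=> phi); split=> //; split=> //.
    by rewrite big_const card_unit /= addr0.
  by move=> x; rewrite big_const card_unit /= addr0.
have [_ [I [J [us [fs [p ->]]]]] pe] := sup_adherent eta0 hs.
pose c i j := fs j (M (us i)) / fs j (K (us i)).
have [us0 uE fs0 fE] := p.
exists I, J, us, fs, c; split=> //.
  move=> i j; have [m1 m2] := MK (us0 i); have m3 := functional_mono (fs0 j) m2.
  have m4 := fs0 j _ m1; rewrite /c divr_ge0//=; last exact: le_trans m3.
  have [->|f0] := eqVneq (fs j (K (us i))) 0; first by rewrite invr0 mulr0.
  by rewrite ler_pdivrMr ?mul1r// lt0r f0; exact: le_trans m3.
move=> xs gs xu gf.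
have p' := refine_partition p xu gf.
have [us' [fs' e']] : exists us' fs', partition_of us' fs' /\
    energy us fs + \sum_i \sum_j gs j (K (xs i)) *
      (gs j (M (xs i)) / gs j (K (xs i)) - c i j) ^+ 2 <=
    @energy (I * bool)%type (J * bool)%type us' fs'.
  by do 2 eexists; split; [exact: p'|exact: energy_refine].
have le1 : energy us' fs' <= sup En.
  apply: (sup_upper_bound hs).
  by exists (I * bool)%type, (J * bool)%type, us', fs'; case: e'.
have le2 := le_trans e'.2 le1.
set Q := \sum_i \sum_j _ in le2.
have Qe : Q <= k * (e / 2) by move: pe le2; rewrite -/En; lra.
apply: (@le_trans _ _ (\sum_i \sum_j (k * gs j (K (xs i)) +
  gs j (K (xs i)) * (gs j (M (xs i)) / gs j (K (xs i)) - c i j) ^+ 2 / k))).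
  apply: le_trans (ler_norm_sum _ _ _) _; apply: ler_sum => i _.
  apply: le_trans (ler_norm_sum _ _ _) _; apply: ler_sum => j _.
  have [x0 _] := xu i; have [mx mk] := MK x0.
  have gp : positive_functional (gs j) by move=> y y0; have [] := gf j y y0.
  by apply: dist_mul_le_sqr => //; [exact: gp|exact: functional_mono].
under eq_bigr do rewrite big_split/= -mulr_sumr -mulr_suml.
rewrite big_split/= -mulr_sumr -mulr_suml -/Q.
have h1 : \sum_i \sum_j gs j (K (xs i)) <= m.
  apply: (@le_trans _ _ (phi (K u))); last by rewrite /m lerDl.
  rewrite -(partition_mass p); apply: ler_sum => i _; apply: ler_sum => j _.
  have [x0 xi] := xu i; apply: (@le_trans _ _ (fs j (K (xs i)))).
    by have [] := gf j _ (K0 x0).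
  by apply: functional_mono => //; exact: pos_mono.
have h2 : k * \sum_i \sum_j gs j (K (xs i)) <= e / 2.
  apply: (@le_trans _ _ (k * m)); first by rewrite ler_pM2l.
  by rewrite /k divfK// gt_eqF.
have h3 : Q / k <= e / 2 by rewrite ler_pdivrMr// mulrC.
lra.
Qed.

(** Split [z] along a partition of almost maximal energy and colour each piece by its image under
    [K]. Against functionals below the [fs j], [M] acts on the pieces almost as [c i j] times [K],
    so equal colours give close images under [M]. *)
Lemma dominated_interval_tbounded :
  (exists2 C : R, 0 <= C & forall x, `|phi x| <= C * `|x|) ->
  tbounded ball1 (fun x y => `|K x - K y|) ->
  tbounded [set z | 0 <=: z /\ z <=: u] (fun y z => phi (modulus (M y - M z))).
Proof.
move=> [C C0 phiC] tb e e0.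
have e8 : 0 < e / 8 by rewrite divr_gt0.
have [I [J [us [fs [c [p c01 app]]]]]] := bilinear_approx e8.
have [us0 uE fs0 fE] := p.
(* [N] makes [#|I|%:R * (C * (e / N))], the bound on [W] below, at most [e / 4]. *)
pose N := (2 * #|I|%:R * C + 1) * 2.
have N0 : 0 < N by rewrite mulr_gt0// ltr_wpDl// !mulr_ge0.
have d0 : 0 < e / N by rewrite divr_gt0.
have [T [t tP]] := tbounded_ball_scale `|u| tb d0.
have /choice[xs xsP] z : exists xs : I -> B, 0 <=: z -> z <=: u ->
    (forall i, 0 <=: xs i /\ xs i <=: us i) /\ z = \sum_i xs i.
  have [[z0 zu]|h] := pselect (0 <=: z /\ z <=: u); last first.
    by exists (fun=> 0) => z0 zu; case: h.
  have [|xs xsP] := riesz_decomp us0 z0; first by rewrite -uE.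
  by exists xs.
exists {ffun I -> T}, (fun z => [ffun i => t (xs z i)]).
move=> y z [y0 yu] [z0 zu] /ffunP tyz.
have [xy yE] := xsP y y0 yu; have [xz zE] := xsP z z0 zu.
have xu x i : (0 <=: xs x i /\ xs x i <=: us i) -> `|xs x i| <= `|u|.
  move=> [x0 xi]; apply: norm_mono => //; apply: ble_trans xi _.
  by rewrite uE; exact: ble_sum_term.
have Kd i : `|K (xs y i) - K (xs z i)| <= e / N.
  by apply: tP; [exact: xu|exact: xu|have := tyz i; rewrite !ffunE].
(* With [gs j w = fs j (ppart w)], the sum of the [gs j w] is [phi (ppart w)]. Both signs are
   treated because the modulus is the sum of the two positive parts. *)
have key w : w = M y - M z \/ w = - (M y - M z) -> phi (ppart w) <= e / 2.
  move=> wE.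
  have /choice[gs gsP] j : exists g : {scalar B}, functional_le g (fs j) /\
      g w = fs j (ppart w).
    by have [g] := ppart_functional w (fs0 j); exists g.
  have gf j : functional_le (gs j) (fs j) by have [] := gsP j.
  have -> : phi (ppart w) = \sum_j gs j w.
    by rewrite fE; apply: eq_bigr => j _; have [_ ->] := gsP j.
  have : `|\sum_j gs j (M y - M z)| <= e / 2.
    pose Z x := \sum_i \sum_j (gs j (M (xs x i)) - c i j * gs j (K (xs x i))).
    have Zy : `|Z y| <= e / 8 by exact: app.
    have Zz : `|Z z| <= e / 8 by exact: app.
    pose W := \sum_i \sum_j c i j * gs j (K (xs y i) - K (xs z i)).
    have -> : \sum_j gs j (M y - M z) = Z y - Z z + W.
      rewrite /Z /W -sumrB -big_split/= {1}yE {1}zE.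
      under eq_bigr do rewrite linearB !linear_sum -big_split/=.
      rewrite exchange_big/=; apply: eq_bigr => i _.
      rewrite -sumrB -big_split/=; apply: eq_bigr => j _.
      by rewrite linearB/=; ring.
    have We : `|W| <= e / 4.
      apply: (@le_trans _ _ (\sum_(i : I) C * (e / N))).
        apply: le_trans (ler_norm_sum _ _ _) _; apply: ler_sum => i _.
        apply: le_trans (ler_norm_sum _ _ _) _.
        set v := K _ - K _.
        apply: (@le_trans _ _ (phi (modulus v))).
          rewrite fE; apply: ler_sum => j _; rewrite normrM.
          apply: le_trans (functional_modulus v (gf j)).
          have /andP[ca cb] := c01 i j.
          by rewrite (ger0_norm ca) -[leRHS]mul1r ler_wpM2r.
        apply: le_trans (ler_norm _) _; apply: le_trans (phiC _) _.
        by rewrite norm_modulus ler_wpM2l//; exact: Kd.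
      have -> : \sum_(i : I) C * (e / N) = #|I|%:R * (C * (e / N)).
        by rewrite sumr_const mulr_natl.
      have -> : #|I|%:R * (C * (e / N)) = e * ((2 * #|I|%:R * C) / N) / 2.
        by field; rewrite gt_eqF.
      rewrite (_ : e / 4 = e * (1 / 2) / 2); last by lra.
      rewrite ler_pM2r ?invr_gt0// ler_pM2l// ler_pdivrMr// /N; lra.
    apply: le_trans (ler_normD _ _) _.
    have := ler_normB (Z y) (Z z); lra.
  rewrite ler_norml => /andP[h1 h2]; case: wE => -> //.
  by under eq_bigr do rewrite linearN; rewrite sumrN; lra.
rewrite modulusE linearD/=.
have := key _ (or_introl erefl); have := key _ (or_intror erefl); lra.
Qed.

End Energy.

(** The positive and negative parts of [x] are coloured separately, through truncated images in the
    order interval from 0 to [u]. For each part, truncation costs [e / 12] twice and the comparison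
    through [phi] costs [e / 3]. *)
Lemma dominated_comp3_tbounded (A M D KA KM KD : {linear B -> B}) :
  positive_le A KA -> positive_le M KM -> positive_le D KD ->
  tbounded ball1 (fun x y => `|KA x - KA y|) ->
  tbounded ball1 (fun x y => `|KM x - KM y|) ->
  tbounded ball1 (fun x y => `|KD x - KD y|) ->
  tbounded ball1 (fun x y => `|A (M (D x)) - A (M (D y))|).
Proof.
move=> AK MK DK tA tM tD e e0.
have [A0 _] := positive_le_pos AK; have [M0 _] := positive_le_pos MK.
have [D0 _] := positive_le_pos DK.
have [a a0 Aa] := pos_bounded A0; have [m m0 Mm] := pos_bounded M0.
pose am := 12 * (a * m + 1).
have am0 : 0 < am by rewrite mulr_gt0// ltr_wpDl// mulr_ge0.
have e1 : 0 < e / am by rewrite divr_gt0.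
have [u u0 uP] := dominated_order_bounded DK tD e1.
pose mu := 12 * (m * `|u| + 1).
have mu0 : 0 < mu by rewrite mulr_gt0// ltr_wpDl// mulr_ge0.
have e2 : 0 < e / mu by rewrite divr_gt0.
have [phi [phi0 phiC phiP]] := dominated_dual_bounded AK tA e2.
have e6 : 0 < e / 6 by rewrite divr_gt0.
have [I [c cP]] := dominated_interval_tbounded MK u0 phi0 phiC tM e6.
(* [z x] is the meet of [D x] and [u]. *)
pose z x := D x - ppart (D x - u).
have zP x : 0 <=: x -> 0 <=: z x /\ z x <=: u.
  move=> x0; have Dx0 := D0 _ x0; split.
    rewrite ble_sub0; apply: ppart_le => //.
    by rewrite ble_subl_addr ble_addl.
  by rewrite ble_subl_addr addrC -ble_subl_addr ble_ppart.
have key x y : 0 <=: x -> 0 <=: y -> `|x| <= 1 -> `|y| <= 1 -> c (z x) = c (z y) ->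
    `|A (M (D x)) - A (M (D y))| <= e / 2.
  move=> x0 y0 x1 y1 cxy.
  have [zx0 zxu] := zP _ x0; have [zy0 zyu] := zP _ y0.
  have res t : 0 <=: t -> `|t| <= 1 -> `|A (M (ppart (D t - u)))| <= e / 12.
    move=> t0 t1; apply: le_trans (Aa _) _.
    apply: (@le_trans _ _ (a * (m * (e / am)))).
      rewrite ler_wpM2l//; apply: le_trans (Mm _) _; rewrite ler_wpM2l//.
      exact: uP.
    have -> : a * (m * (e / am)) = e / 12 * ((12 * (a * m)) / am).
      by field; rewrite gt_eqF.
    rewrite -[leRHS]mulr1 ler_wpM2l//; first by rewrite ltW// divr_gt0.
    by rewrite ler_pdivrMr// mul1r /am; lra.
  have mid : `|A (M (z x)) - A (M (z y))| <= e / 3.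
    rewrite -linearB; apply: le_trans (norm_pos_modulus A0 _) _.
    apply: le_trans (phiP _ _) _ => //.
    have p1 : phi (modulus (M (z x) - M (z y))) <= e / 6 by exact: cP.
    suff p2 : e / mu * `|modulus (M (z x) - M (z y))| <= e / 6 by lra.
    rewrite norm_modulus.
    have Mz t : 0 <=: t -> t <=: u -> `|M t| <= m * `|u|.
      by move=> t0 tu; apply: le_trans (Mm _) _; rewrite ler_wpM2l// norm_mono.
    have : `|M (z x) - M (z y)| <= 2 * (m * `|u|).
      apply: le_trans (ler_normB _ _) _.
      by have := Mz _ zx0 zxu; have := Mz _ zy0 zyu; lra.
    move=> h; apply: (@le_trans _ _ (e / mu * (2 * (m * `|u|)))).
      by rewrite ler_wpM2l// ltW.
    have -> : e / mu * (2 * (m * `|u|)) = e / 6 * ((12 * (m * `|u|)) / mu).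
      by field; rewrite gt_eqF.
    rewrite -[leRHS]mulr1 ler_wpM2l//; first by rewrite ltW.
    by rewrite ler_pdivrMr// mul1r /mu; lra.
  have E t : A (M (D t)) = A (M (z t)) + A (M (ppart (D t - u))).
    by rewrite -!linearD subrK.
  rewrite !E opprD addrACA; apply: le_trans (ler_normD _ _) _.
  have := ler_normB (A (M (ppart (D x - u)))) (A (M (ppart (D y - u)))).
  have := res _ x0 x1; have := res _ y0 y1; lra.
exists (I * I)%type, (fun x => (c (z (ppart x)), c (z (ppart (- x))))).
move=> x y x1 y1 [cp cn].
have pb t : ball1 t -> `|ppart t| <= 1 by apply: le_trans; exact: norm_ppart.
have nb t : ball1 t -> `|ppart (- t)| <= 1.
  by move=> t1; apply: le_trans (norm_ppart _) _; rewrite normrN.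
have E t : A (M (D t)) = A (M (D (ppart t))) - A (M (D (ppart (- t)))).
  by rewrite -!linearB -ppart_sub.
rewrite (E x) (E y) opprD addrACA -opprD.
apply: le_trans (ler_normB _ _) _; rewrite [leRHS]splitr.
by apply: lerD; apply: key => //; auto.
Qed.

End Domination.

(** * Positive resolvents and the spectral radius *)

Section Neumann.
Context {R : realType} {B : completeNormedModType R}.

Lemma affine_fixed_point (A : {linear B -> B}) (q : R) (v : B) :
  0 <= q -> q < 1 -> (forall x, `|A x| <= q * `|x|) -> exists u, u = v + A u.
Proof.
move=> q0 q1 Aq; pose g := totalfun (fun u : B => v + A u).
have [|||p _ pg] := @banach_fixed_point R B setT g; last by exists p.
- exists (NngNum q0); split=> //= -[x y] _ /=.
  by rewrite opprD addrACA subrr add0r -linearB; exact: Aq.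
- exact: closedT.
- by exists 0.
Qed.

Lemma affine_fixed_point_norm (A : {linear B -> B}) (q c : R) (u v : B) :
  q < 1 -> `|A u| <= q * `|u| -> `|v| <= c -> u = v + A u ->
  `|u| <= c / (1 - q).
Proof.
move=> q1 Aq vc uE; rewrite ler_pdivlMr ?subr_gt0// mulrBr mulr1 lerBlDr mulrC.
by rewrite {1}uE; apply: le_trans (ler_normD _ _) _; exact: lerD.
Qed.

End Neumann.

(** * Positivity of resolvents and the associated gauge *)

Section Resolvent.
Context {R : realType} {B : banachLatticeType R}.
Implicit Types (x y v : B).

(** The negative part [n] of [u] satisfies [n <=: A n], whence [|n| <= q * |n|] and [n = 0]. *)
Lemma affine_fixed_point_ge0 (A : {linear B -> B}) (q : R) (u v : B) :
  positive_operator A -> q < 1 -> (forall x, `|A x| <= q * `|x|) ->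
  0 <=: v -> u = v + A u -> 0 <=: u.
Proof.
move=> A0 q1 Aq v0 uE; set n := ppart (- u); have n0 : 0 <=: n by exact: ppart_ge0.
have nA : n <=: A n.
  apply: ppart_le; last by apply: A0.
  rewrite {1}uE opprD -linearN addrC; apply: (@ble_trans _ _ (A (- u))).
    by rewrite ble_subl_addr ble_addl.
  exact: pos_mono.
have nq : `|n| <= q * `|n| by apply: le_trans (Aq _); exact: norm_mono.
have nE : n = 0.
  apply/eqP; rewrite -normr_eq0; apply/eqP/le_anti; rewrite normr_ge0 andbT.
  by rewrite -(pmulr_rle0 _ (_ : 0 < 1 - q)) ?subr_gt0// mulrBl mul1r subr_le0.
by rewrite -ble_opp oppr0 -nE; exact: ble_ppart.
Qed.

Definition resolvent (S : B -> B) (m : R) (T : B -> B) :=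
  (forall x, m *: T x - S (T x) = x) /\ (forall x, T (m *: x - S x) = x).

(** The resolvent identity, arranged so that for linear [T] it makes [U x] a fixed point of
    [u |-> T x + (m - n) *: T u]. *)
Lemma resolvent_shift (S : B -> B) (m n : R) (T U : B -> B) x :
  resolvent S m T -> resolvent S n U -> U x = T (x + (m - n) *: U x).
Proof.
move=> [_ TS] [SU _]; rewrite -{2}(SU x) -[LHS]TS; congr T.
by rewrite scalerBl [RHS]addrC addrA subrK.
Qed.

Section PositiveResolvent.
Variable S : {linear B -> B}.
Hypothesis S0 : positive_operator S.
Variable r : R.
Hypothesis r0 : 0 <= r.
Hypothesis res : forall m, r < m -> exists2 T : {linear B -> B},
  resolvent S m T & exists2 c : R, 0 < c & forall x, `|T x| <= c * `|x|.

Let W := [set m : R | r < m /\ exists2 T : {linear B -> B},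
  resolvent S m T & positive_operator T].

(** For [m] above the bound [s] of [S], [T x] is the fixed point of the contraction
    [u |-> m^-1 *: x + m^-1 *: S u]. *)
Lemma positive_resolvent_large : W !=set0.
Proof.
have [s s0 Ss] := pos_bounded S0.
pose m := r + s + 1; have rm : r < m by rewrite /m; lra.
have m0 : 0 < m by have := r0; rewrite /m; lra.
exists m; split=> //; have [T [T1 T2] _] := res rm; exists T => // x x0.
apply: (@affine_fixed_point_ge0 (m^-1 \*: S) (s / m) _ (m^-1 *: x)).
- by move=> y y0; apply: bl_scale_ge0; [rewrite invr_ge0 ltW|apply: S0].
- by rewrite ltr_pdivrMr// mul1r; have := r0; rewrite /m; lra.
- move=> y /=; rewrite normrZ gtr0_norm ?invr_gt0// [s / m]mulrC -mulrA.
  by rewrite ler_pM2l ?invr_gt0.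
- by apply: bl_scale_ge0 => //; rewrite invr_ge0 ltW.
- by rewrite /= -{2}(T1 x) scalerBr scalerA mulVf ?gt_eqF// scale1r subrK.
Qed.

Lemma positive_resolvent_left (m n c : R) (T : {linear B -> B}) :
  r < n -> n <= m -> resolvent S m T -> positive_operator T ->
  (forall x, `|T x| <= c * `|x|) -> (m - n) * c < 1 -> W n.
Proof.
move=> rn nm mT T0 Tc mnc; split=> //; have [U nU _] := res rn.
exists U => // x x0.
apply: (@affine_fixed_point_ge0 ((m - n) \*: T) ((m - n) * c) _ (T x)) => //.
- by move=> y y0; apply: bl_scale_ge0; [rewrite subr_ge0|apply: T0].
- move=> y /=; rewrite normrZ ger0_norm ?subr_ge0// -mulrA.
  by rewrite ler_wpM2l ?subr_ge0.
- by apply: T0.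
- by rewrite [LHS](resolvent_shift x mT nU) linearD linearZ.
Qed.

(** If the infimum [m0] exceeded [r], the bound [c] of the resolvent at [m0] would control those at
    nearby [m] in [W], and a descent from such an [m] would reach below [m0]. *)
Lemma positive_resolvent_inf : inf W <= r.
Proof.
have hlb : has_lbound W by exists r => m [/ltW].
have hW : has_inf W by split=> //; exact: positive_resolvent_large.
rewrite leNgt; apply/negP => rW; set m0 := inf W in rW.
have [T0 mT0 [c c0 Tc]] := res rW.
(* Within [d] of [m0] the resolvent is bounded by [c / (1 - 1 / 4) <= 2 * c], which allows any
   descent shorter than [2 * d]. *)
pose d := (4 * c)^-1; have d0 : 0 < d by rewrite invr_gt0 mulr_gt0.
have [m [rm [T mT Tpos]] mW] := inf_adherent d0 hW.
have m0m : m0 <= m by apply: ge_inf => //; split=> //; exists T.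
have dc : d * c = 1 / 4 by rewrite /d; field; rewrite gt_eqF.
have Tc2 x : `|T x| <= 2 * c * `|x|.
  have := resolvent_shift x mT0 mT; rewrite linearD linearZ /= => TE.
  have : `|T x| <= (c * `|x|) / (1 - 1 / 4).
    apply: (@affine_fixed_point_norm _ _ ((m0 - m) \*: T0) _ _ _ (T0 x)) => //.
      lra.
    rewrite /= normrZ distrC ger0_norm ?subr_ge0//.
    apply: (@le_trans _ _ (d * (c * `|T x|))); last by rewrite mulrA dc.
    by apply: ler_pM => //; rewrite ?subr_ge0// lerBlDl ltW.
  move=> /le_trans; apply; rewrite ler_pdivrMr; last lra.
  by have := mulr_ge0 (ltW c0) (normr_ge0 x); lra.
(* The midpoint keeps [n] above [r]; the other term keeps [m - n] below [5 / 4 * d]. *)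
pose n := Num.max (m0 - d / 4) ((r + m0) / 2).
have rn : r < n by rewrite /n lt_max; apply/orP; right; lra.
have nm0 : n < m0 by rewrite /n gt_max; apply/andP; split; lra.
have dn : m0 - d / 4 <= n by rewrite /n le_max lexx.
have : W n.
  apply: (positive_resolvent_left rn _ mT Tpos Tc2).
    by rewrite ltW// (lt_le_trans nm0).
  have : (m - n) * c <= (5 / 4 * d) * c.
    rewrite ler_pM2r//; have : m < m0 + d by []; lra.
  rewrite -mulrA dc; lra.
by move=> /(ge_inf hlb); rewrite leNgt nm0.
Qed.

(* The resolvent need not be positive at [m] itself: positivity is only
   propagated downwards from large values. *)
Lemma positive_resolvent_between (m : R) : r < m ->
  exists2 n, r < n < m & exists2 T : {linear B -> B},
    resolvent S n T & positive_operator T.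
Proof.
move=> rm; have hW : has_inf W.
  by split; [exact: positive_resolvent_large|exists r => k [/ltW]].
have mr : 0 < m - r by rewrite subr_gt0.
have [n [rn nT] nW] := inf_adherent mr hW.
exists n => //; rewrite rn/=; have := positive_resolvent_inf; lra.
Qed.

End PositiveResolvent.

(* The gauge is [N x = |T |x| |]: since [T S = m T - 1 <= m T], the operator [S],
   and whatever it dominates, contracts [N] by the factor [m]. *)
Lemma gauge_of_resolvent (S : {linear B -> B}) (m : R) (T : {linear B -> B}) :
  0 < m -> positive_operator S -> resolvent S m T -> positive_operator T ->
  exists2 N : B -> R,
    [/\ forall x y, N (x + y) <= N x + N y,
        exists2 c : R, 0 < c & forall x, N x <= c * `|x| &
        forall x, `|x| <= m * N x] &
    forall U : {linear B -> B}, positive_le U S -> forall x, N (U x) <= m * N x.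
Proof.
move=> m0 S0 [T1 T2] T0.
have TS x : T (S x) = m *: T x - x.
  by rewrite -{3}(T2 x) linearB linearZ opprB addrC subrK.
exists (fun x => `|T (modulus x)|); first split.
- move=> x y; apply: le_trans (ler_normD _ _); rewrite -linearD.
  apply: norm_mono; first by apply: T0.
  apply: pos_mono => //; apply: modulus_le; first by apply: ble_add; exact: ble_modulus.
  by rewrite opprD; apply: ble_add; exact: ble_modulusN.
- have [c c0 Tc] := pos_bounded T0; exists (c + 1); first by rewrite ltr_wpDl.
  move=> x; rewrite -(norm_modulus x); apply: le_trans (Tc _) _.
  by rewrite ler_wpM2r// lerDl.
- move=> x; rewrite -(norm_modulus x) -[X in X * _](gtr0_norm m0) -normrZ.
  apply: norm_mono => //; rewrite -[m *: _](subrK (S (T (modulus x)))) T1.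
  by apply: ble_addl; apply: S0; apply: T0.
- move=> U US x; rewrite -[X in X * _](gtr0_norm m0) -normrZ.
  have [U0 _] := positive_le_pos US.
  apply: norm_mono; first by apply: T0.
  apply: (@ble_trans _ _ (T (S (modulus x)))).
    apply: pos_mono => //; apply: (ble_trans (pos_modulus U0 x)).
    by have [] := US _ (modulus_ge0 x).
  by rewrite TS ble_subl_addr ble_addl.
Qed.

End Resolvent.

(** * The spectrum through the complexification *)

Lemma csub_identity (R : comNzRingType) (V : lmodType R) (a b : R) (p q r s t : V) :
  a *: (a *: p - b *: q - r) + b *: (b *: p + a *: q - s) -
    (a *: r - b *: s - t) = (a * a + b * b) *: p - ((2 * a) *: r - t).
Proof.
(* Formal combinations of the five vectors reduce the identity to scalar identities for [ring]. *)
pose comb c1 c2 c3 c4 c5 : V :=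
  c1 *: p + (c2 *: q + (c3 *: r + (c4 *: s + c5 *: t))).
have combD c1 c2 c3 c4 c5 d1 d2 d3 d4 d5 :
    comb c1 c2 c3 c4 c5 + comb d1 d2 d3 d4 d5 =
    comb (c1 + d1) (c2 + d2) (c3 + d3) (c4 + d4) (c5 + d5).
  by rewrite /comb !scalerDl; do 4 (rewrite addrACA; congr (_ + _)).
have combZ k c1 c2 c3 c4 c5 : k *: comb c1 c2 c3 c4 c5 =
    comb (k * c1) (k * c2) (k * c3) (k * c4) (k * c5).
  by rewrite /comb !scalerDr !scalerA.
have combN c1 c2 c3 c4 c5 : - comb c1 c2 c3 c4 c5 =
    comb (- c1) (- c2) (- c3) (- c4) (- c5).
  by rewrite /comb !scaleNr !opprD.
have key p' q' r' s' t' : p' = comb 1 0 0 0 0 -> q' = comb 0 1 0 0 0 ->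
    r' = comb 0 0 1 0 0 -> s' = comb 0 0 0 1 0 -> t' = comb 0 0 0 0 1 ->
    a *: (a *: p' - b *: q' - r') + b *: (b *: p' + a *: q' - s') -
    (a *: r' - b *: s' - t') = (a * a + b * b) *: p' - ((2 * a) *: r' - t').
  move=> -> -> -> -> ->; rewrite !(combZ, combN, combD).
  by congr comb; ring.
by apply: key; rewrite /comb !scale1r !scale0r ?add0r ?addr0.
Qed.

Section Spectrum.
Context {R : realType} {B : banachLatticeType R}.
Variable S : {linear B -> B}.

Lemma csub_comp (a b : R) (v : B * B) (l := Complex a b) (l' := Complex a (- b)) :
  complexified_sub S l (complexified_sub S l' v) =
  ((a * a + b * b) *: v.1 - ((2 * a) *: S v.1 - S (S v.1)),
   (a * a + b * b) *: v.2 - ((2 * a) *: S v.2 - S (S v.2))).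
Proof.
rewrite /complexified_sub /=; case: v => p q /=; congr pair.
  have -> : S (a *: p - - b *: q - S p) = a *: S p - - b *: S q - S (S p).
    by rewrite !linearB !linearZ.
  have := csub_identity a (- b) p q (S p) (S q) (S (S p)).
  by rewrite mulrNN -[- (b *: _)]scaleNr.
have e (u v w : B) : - b *: u + a *: v - w = a *: v - b *: u - w.
  by rewrite scaleNr [- _ + _]addrC.
have -> : S (- b *: p + a *: q - S q) = a *: S q - b *: S p - S (S q).
  by rewrite e !linearB !linearZ.
rewrite e scaleNr opprK [b *: (_ - _) + _]addrC [a *: p + _]addrC.
exact: csub_identity.
Qed.

(** At a real point the complexified operator acts on each component separately, so the first
    component of the inverse on [(x, 0)] is the resolvent; its bound comes from the continuity of
    [V]. *)
Lemma scalar_notin_spectrum (m : R) : ~ spectrum S (Complex m 0) ->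
  exists2 T : {linear B -> B}, resolvent S m T &
    exists2 c : R, 0 < c & forall x, `|T x| <= c * `|x|.
Proof.
move=> /contrapT[V [Vc VK KV]].
pose t x := (V (x, 0)).1.
have t1 x : m *: t x - S (t x) = x.
  have := congr1 fst (KV (x, 0)); rewrite /complexified_sub /=.
  by rewrite scale0r subr0.
have S00 : S 0 = 0 by exact: linear0.
have t2 x : t (m *: x - S x) = x.
  have := VK (x, 0); rewrite /complexified_sub /= S00 !scaler0 scale0r !subr0 addr0.
  by rewrite /t => ->.
have tl : linear t.
  move=> a x y; rewrite -[RHS]t2; congr t.
  have -> : S (a *: t x + t y) = a *: S (t x) + S (t y) by exact: linearP.
  by rewrite scalerDr scalerA mulrC -scalerA opprD addrACA -scalerBr !t1.
pose T : {linear B -> B} := HB.pack t (GRing.isLinear.Build _ _ _ _ t tl).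
exists T => //.
have Tc : continuous T.
  move=> x; apply: (@cvg_comp _ _ _ (fun x => V (x, 0)) fst _ (nbhs (V (x, 0)))).
    apply: (@cvg_comp _ _ _ (fun x : B => (x, 0 : B)) V _ (nbhs (x, 0 : B)));
      last exact: Vc.
    exact: (cvg_pair cvg_id (cvg_cst _)).
  exact: cvg_fst.
have /linear_boundedP/pinfty_ex_gt0[c c0 cP] := (linear_bounded_continuous T).2 Tc.
by exists c.
Qed.

(* [l - S] times [conj l - S] acts on both components as the real operator
   [|l|^2 - 2 (Re l) S + S^2], which a Neumann series inverts. *)
Lemma notin_spectrum_large (s : R) (l : R[i]) : 0 <= s ->
  (forall x, `|S x| <= s * `|x|) -> 3 * s + 1 < ComplexField.Normc.normc l ->
  ~ spectrum S l.
Proof.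
move=> s0 Ss; case: l => a b; set rho := ComplexField.Normc.normc _ => rs; apply.
have rho2 : rho ^+ 2 = a * a + b * b.
  by rewrite /rho/= sqr_sqrtr -?expr2// addr_ge0// sqr_ge0.
have rho0 : 0 < rho by apply: le_lt_trans rs; rewrite addr_ge0// mulr_ge0.
have arho : `|a| <= rho.
  rewrite -(ler_pXn2r (n := 2))// ?nnegrE ?(ltW rho0)// real_normK ?num_real//.
  by rewrite rho2 expr2 lerDl -expr2 sqr_ge0.
set n2 := a * a + b * b in rho2.
have n20 : 0 < n2 by rewrite -rho2 exprn_gt0.
pose A : {linear B -> B} := n2^-1 \*: ((2 * a) \*: S \- (S \o S)).
(* Since [|a| <= rho] and [s <= rho / 3], the factor is [2 / 3 + 1 / 9]. *)
have Aq x : `|A x| <= 7 / 9 * `|x|.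
  rewrite /A /= normrZ gtr0_norm ?invr_gt0// ler_pdivrMl//.
  apply: le_trans (ler_normB _ _) _; rewrite normrZ normrM (ger0_norm (ler0n _ 2)).
  have h1 := Ss x; have h2 := Ss (S x); have h3 := normr_ge0 x.
  have h4 : `|S (S x)| <= s * (s * `|x|).
    by apply: le_trans h2 _; rewrite ler_wpM2l.
  have h5 : `|a| * `|S x| <= rho * (s * `|x|) by rewrite ler_pM.
  have sr : s <= rho / 3 by lra.
  have h6 : rho * (s * `|x|) <= rho * (rho / 3 * `|x|).
    by rewrite ler_wpM2l ?(ltW rho0)// ler_wpM2r.
  have h7 : s * (s * `|x|) <= rho / 3 * (rho / 3 * `|x|).
    by rewrite ler_pM ?mulr_ge0// ler_wpM2r.
  have -> : n2 * (7 / 9 * `|x|) = 7 / 9 * (rho * (rho * `|x|)) by rewrite -rho2; ring.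
  lra.
have /choice[g gP] v : exists u, u = v + A u.
  by apply: (affine_fixed_point _ _ _ Aq); lra.
have gl v w : `|g v - g w| <= 9 / 2 * `|v - w|.
  have := @affine_fixed_point_norm _ _ A (7 / 9) `|v - w| (g v - g w) (v - w).
  rewrite (_ : `|v - w| / (1 - 7 / 9) = 9 / 2 * `|v - w|); last by field.
  apply => //; first by lra.
  by rewrite linearB {1}(gP v) {1}(gP w) opprD addrACA.
have gc : continuous g.
  move=> v; apply/cvgrPdist_le => e e0.
  have d0 : 0 < e / (9 / 2) by rewrite divr_gt0//; lra.
  near=> w; apply: le_trans (gl v w) _; rewrite -ler_pdivlMl; last by lra.
  rewrite mulrC; near: w; exact: cvgr_dist_le.
have Sc : continuous S.
  apply/linear_bounded_continuous/linear_boundedP.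
  exists s; split; first exact: num_real.
  by move=> t /ltW st x; apply: le_trans (Ss x) _; rewrite ler_wpM2r.
pose k (v : B * B) := (g (n2^-1 *: v.1), g (n2^-1 *: v.2)).
have nA u : n2 *: u - ((2 * a) *: S u - S (S u)) = n2 *: (u - A u).
  by rewrite scalerBr /A/= scalerA mulfV ?gt_eqF// scale1r.
have gE v : n2 *: (g (n2^-1 *: v) - A (g (n2^-1 *: v))) = v.
  by rewrite {1}(gP (n2^-1 *: v)) addrK scalerA mulfV ?gt_eqF// scale1r.
have LK v : complexified_sub S (Complex a b)
    (complexified_sub S (Complex a (- b)) (k v)) = v.
  by rewrite csub_comp /k /= !nA !gE; case: v.
exists (fun v => complexified_sub S (Complex a (- b)) (k v)); split.
- move=> v; rewrite /complexified_sub /=.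
  have kc (f : B * B -> B) : {for v, continuous f} ->
      {for v, continuous (fun v => g (n2^-1 *: f v))}.
    move=> fc; apply: (@cvg_comp _ _ _ (fun v => n2^-1 *: f v) g); last exact: gc.
    by apply: cvgZ; [exact: cvg_cst|exact: fc].
  have k1 : {for v, continuous (fun v : B * B => g (n2^-1 *: v.1))}.
    by apply: (kc fst); exact: cvg_fst.
  have k2 : {for v, continuous (fun v : B * B => g (n2^-1 *: v.2))}.
    by apply: (kc snd); exact: cvg_snd.
  apply: cvg_pair; apply: cvgB.
  + by apply: cvgB; (apply: cvgZ; [exact: cvg_cst|]); [exact: k1|exact: k2].
  + exact: (@cvg_comp _ _ _ _ S _ _ _ k1 (Sc _)).
  + by apply: cvgD; (apply: cvgZ; [exact: cvg_cst|]); [exact: k1|exact: k2].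
  + exact: (@cvg_comp _ _ _ _ S _ _ _ k2 (Sc _)).
- move=> u.
  (* For the left inverse: the conjugate factors commute and their product is injective, because [A]
     is a strict contraction. *)
  have inj x y : n2 *: (x - A x) = n2 *: (y - A y) -> x = y.
    move=> /(congr1 (fun z => n2^-1 *: z)).
    rewrite !scalerA mulVf ?gt_eqF// !scale1r => xy.
    have xyE : x - y = 0 + A (x - y).
      have xe : x = y - A y + A x by rewrite -xy subrK.
      by rewrite add0r linearB {1}xe addrAC (addrAC y) subrr add0r addrC.
    have := @affine_fixed_point_norm _ _ A (7 / 9) 0 (x - y) 0.
    rewrite mul0r normr0 normr_le0 subr_eq0 => H; apply/eqP/H => //; lra.
  set w := complexified_sub S _ (k _).
  have Lw : complexified_sub S (Complex a b) w = complexified_sub S (Complex a b) u.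
    exact: LK.
  have := congr1 (complexified_sub S (Complex a (- b))) Lw.
  have comp' v : complexified_sub S (Complex a (- b))
      (complexified_sub S (Complex a b) v) =
      (n2 *: (v.1 - A v.1), n2 *: (v.2 - A v.2)).
    by have := csub_comp a (- b) v; rewrite /= opprK mulrNN -/n2 !nA.
  by rewrite !comp'; case: w {Lw} => w1 w2; case: u => u1 u2 /= [/inj -> /inj ->].
- exact: LK.
Unshelve. all: by end_near. Qed.

Lemma spectral_radius_ge0 : 0 <= spectral_radius S.
Proof.
rewrite /spectral_radius; set A := [set _ | _ in _].
(* [sup] is 0 on a set that is empty or unbounded above. *)
have [[x Ax]|h] := pselect (A !=set0); last by rewrite sup_out// => -[].
have [hb|hb] := pselect (has_ubound A); last first.
  by rewrite sup_out// => -[].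
apply: le_trans (ub_le_sup hb Ax); case: Ax => -[a b] _ <- /=; exact: sqrtr_ge0.
Qed.

(** [notin_spectrum_large] bounds the spectrum, so [sup] is a genuine upper bound of the moduli and
    [m] avoids the spectrum. *)
Lemma resolvent_gt_spectral_radius (m : R) : positive_operator S ->
  spectral_radius S < m -> exists2 T : {linear B -> B}, resolvent S m T &
    exists2 c : R, 0 < c & forall x, `|T x| <= c * `|x|.
Proof.
move=> S0 rm; apply: scalar_notin_spectrum => mS.
have [s s0 Ss] := pos_bounded S0.
have mA : [set ComplexField.Normc.normc l | l in spectrum S] m.
  exists (Complex m 0) => //=; rewrite expr0n addr0 sqrtr_sqr ger0_norm//.
  exact: le_trans spectral_radius_ge0 (ltW rm).
move: rm; rewrite ltNge => /negP; apply; apply: ub_le_sup mA.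
exists (3 * s + 1) => _ [l lS <-]; rewrite leNgt; apply/negP => h.
exact: notin_spectrum_large s0 Ss h lS.
Qed.

End Spectrum.

(** * Expansion of the powers of P *)

Section Words.
Context {R : realType} {B : banachLatticeType R}.

Let ball1 : set B := [set x | `|x| <= 1].

Definition tb_operator (f : B -> B) := tbounded ball1 (fun x y => `|f x - f y|).

Lemma tb_operator_add (f g : B -> B) : tb_operator f -> tb_operator g ->
  tb_operator (fun x => f x + g x).
Proof.
move=> tf tg e e0; have e2 : 0 < e / 2 by rewrite divr_gt0.
have [I [c cP]] := tf _ e2; have [J [d dP]] := tg _ e2.
exists (I * J)%type, (fun x => (c x, d x)) => x y x1 y1 [cxy dxy].
rewrite opprD addrACA [leRHS]splitr; apply: le_trans (ler_normD _ _) _.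
by apply: lerD; [exact: cP|exact: dP].
Qed.

Lemma tb_operator_compl (Q : {linear B -> B}) (f : B -> B) :
  positive_operator Q -> tb_operator f -> tb_operator (fun x => Q (f x)).
Proof.
move=> Q0 tf e e0; have [C C0 QC] := pos_bounded Q0.
have C1 : 0 < C + 1 by rewrite ltr_wpDl.
have [|I [c cP]] := tf (e / (C + 1)); first by rewrite divr_gt0.
exists I, c => x y x1 y1 cxy; rewrite -linearB; apply: le_trans (QC _) _.
apply: (@le_trans _ _ ((C + 1) * (e / (C + 1)))); last by rewrite mulrC divfK// gt_eqF.
by apply: ler_pM => //; [rewrite lerDl|exact: cP].
Qed.

Lemma tb_operator_compr (Q f : {linear B -> B}) :
  positive_operator Q -> tb_operator f -> tb_operator (fun x => f (Q x)).
Proof.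
move=> Q0 tf e e0; have [C C0 QC] := pos_bounded Q0.
have [I [c cP]] := tbounded_ball_scale C tf e0.
exists I, (fun x => c (Q x)) => x y x1 y1 cxy.
have H z : ball1 z -> `|Q z| <= C.
  by move=> z1; apply: le_trans (QC z) _; rewrite -[leRHS]mulr1 ler_wpM2l.
by apply: cP => //; exact: H.
Qed.

Variables (T U K S : {linear B -> B}).
Hypotheses (TK : positive_le T K) (US : positive_le U S).
Hypothesis tK : tb_operator K.

Let T0 : positive_operator T. Proof. by have [] := positive_le_pos TK. Qed.
Let K0 : positive_operator K. Proof. by have [] := positive_le_pos TK. Qed.
Let U0 : positive_operator U. Proof. by have [] := positive_le_pos US. Qed.
Let S0 : positive_operator S. Proof. by have [] := positive_le_pos US. Qed.

(* [words n k] is the sum of all words of length [n] in [T] and [U] with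
   exactly [k] letters [T]. *)
Fixpoint words (n k : nat) : {linear B -> B} :=
  match n, k with
  | 0, 0 => idfun
  | 0, _.+1 => \0
  | n'.+1, 0 => U \o words n' 0
  | n'.+1, k'.+1 => (U \o words n' k'.+1) \+ (T \o words n' k')
  end.

(** The words of length [n] with at least three letters [T]; the last summand puts a third [T] in
    front of a word with exactly two. *)
Fixpoint many_words (n : nat) : {linear B -> B} :=
  match n with
  | 0 => \0
  | n'.+1 => (T \o many_words n') \+ (U \o many_words n') \+ (T \o words n' 2)
  end.

Lemma iter_words n x : iter n (fun y => T y + U y) x =
  words n 0 x + words n 1 x + words n 2 x + many_words n x.
Proof.
elim: n => [|n IH]; first by rewrite /= !addr0.
rewrite iterS IH /= !linearD /=.
set a0 := T (words n 0 x); set a1 := T (words n 1 x).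
set a2 := T (words n 2 x); set a3 := T (many_words n x).
set b0 := U (words n 0 x); set b1 := U (words n 1 x).
set b2 := U (words n 2 x); set b3 := U (many_words n x).
by rewrite !addrA [LHS](ACl (5*6*1*7*2*4*8*3)).
Qed.

Lemma words_pos n k : positive_operator (words n k).
Proof.
elim: n k => [|n IH] [|k] x x0 //=; first by apply: U0; apply: IH.
by apply: bl_add_ge0; [apply: U0; apply: IH|apply: T0; apply: IH].
Qed.

Lemma words0S n x : words n 0 (U x) = words n.+1 0 x.
Proof. by elim: n => [//|n IH] /=; rewrite IH. Qed.

(** The dominating operator replaces the single [T] by [K] and every [U] to its left by [S]. *)
Lemma words1_dominated n : exists2 D : {linear B -> B},
  positive_le (words n 1) D & tb_operator D.
Proof.
elim: n => [|n [D WD tD]].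
  exists (\0 : {linear B -> B}) => [x x0 /=|]; first by split.
  move=> e e0; exists unit, (fun=> tt) => x y _ _ _ /=.
  by rewrite subrr normr0 ltW.
exists ((S \o D) \+ (K \o words n 0) : {linear B -> B}); last first.
  apply: tb_operator_add; first exact: tb_operator_compl.
  by apply: tb_operator_compr => //; exact: words_pos.
move=> x x0; split; first exact: words_pos.
have [w0 wD] := WD x x0; apply: ble_add => /=.
  by apply: (@ble_trans _ _ (S (words n 1 x))); [have [] := US w0|exact: pos_mono].
by have [] := TK (words_pos n 0 x0).
Qed.

(** Induction on the word with two letters [T]: a leading [U] joins the block [words a 0], while a
    leading [T] yields three dominated factors, [T], [words a 0 \o T] and [words n 1]. *)
Lemma three_letters_tb n a : tb_operator (fun x => T (words a 0 (words n 2 x))).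
Proof.
elim: n a => [|n IH] a.
  move=> e e0; exists unit, (fun=> tt) => x y _ _ _ /=.
  by rewrite subrr normr0 ltW.
have -> : (fun x => T (words a 0 (words n.+1 2 x))) =
  (fun x => T (words a.+1 0 (words n 2 x)) + T (words a 0 (T (words n 1 x)))).
  by apply/funext => x; rewrite -words0S /= !linearD.
apply: tb_operator_add; first exact: IH.
have [D WD tD] := words1_dominated n.
apply: (dominated_comp3_tbounded (M := words a 0 \o T)
  (KM := words a 0 \o K) TK _ WD) => //.
  move=> x x0 /=; have [T1 T2] := TK x0; split; first exact: words_pos.
  by apply: pos_mono T2; exact: words_pos.
by apply: (@tb_operator_compl (words a 0) K) => //; exact: words_pos.
Qed.

Lemma many_words_tb n : tb_operator (many_words n).
Proof.
elim: n => [|n IH].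
  move=> e e0; exists unit, (fun=> tt) => x y _ _ _ /=.
  by rewrite subrr normr0 ltW.
apply: tb_operator_add; last exact: (three_letters_tb n 0).
by apply: tb_operator_add; exact: tb_operator_compl.
Qed.

Lemma many_words_compact n : compact_operator (many_words n).
Proof. exact/tbounded_precompact/many_words_tb. Qed.

(* The weights [1, eta, eta ^+ 2] on words with 0, 1, 2 letters [T] absorb the
   polynomial growth of the number of such words into the gap [rho - m]. *)
Lemma few_words_bound (m rho : R) (Tm : {linear B -> B}) : 0 < m -> m < rho ->
  resolvent S m Tm -> positive_operator Tm ->
  exists2 C : R, 0 < C & forall n x,
    `|words n 0 x + words n 1 x + words n 2 x| <= C * rho ^+ n * `|x|.
Proof.
move=> m0 mrho mT Tm0.
have [N [ND [c c0 Nc] mN] NU] := gauge_of_resolvent m0 S0 mT Tm0.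
have N0 x : 0 <= N x by rewrite -(pmulr_rge0 _ m0) (le_trans _ (mN x)).
have [t t0 Tt] := pos_bounded T0.
(* [N (T x) <= c * |T x| <= c * t * |x| <= c * t * m * N x]; the added 1 makes [tau] positive. *)
pose tau := c * t * m + 1.
have tau0 : 0 < tau by rewrite ltr_wpDl// !mulr_ge0// ltW.
have NT x : N (T x) <= tau * N x.
  apply: le_trans (Nc _) _; apply: (@le_trans _ _ (c * (t * (m * N x)))).
    rewrite ler_wpM2l ?(ltW c0)//; apply: le_trans (Tt _) _.
    by rewrite ler_wpM2l.
  by rewrite /tau !mulrA ler_wpM2r// lerDl.
(* The minimum with 1 makes [eta ^+ 2] the smallest weight; the other term gives
   [tau * eta <= rho - m]. *)
pose eta := Num.min 1 ((rho - m) / tau).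
have eta0 : 0 < eta by rewrite /eta lt_min ltr01 divr_gt0// subr_gt0.
have eta1 : eta <= 1 by rewrite /eta ge_min lexx.
have etau : tau * eta <= rho - m.
  by rewrite mulrC -ler_pdivlMr// /eta ge_min lexx orbT.
have rho0 : 0 <= rho by rewrite ltW// (lt_trans m0).
have bnd n x : N (words n 0 x) + eta * N (words n 1 x) +
    eta ^+ 2 * N (words n 2 x) <= rho ^+ n * N x.
  elim: n => [|n IH].
    have Nz : N 0 = 0.
      by apply/le_anti; rewrite N0 andbT (le_trans (Nc 0))// normr0 mulr0.
    by rewrite /= Nz !mulr0 !addr0 mul1r.
  rewrite [rho ^+ _]exprS -[rho * _ * _]mulrA; apply: le_trans (ler_wpM2l rho0 IH).
  move: (N0 (words n 0 x)) (N0 (words n 1 x)) (N0 (words n 2 x)).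
  have h0 : N (words n.+1 0 x) <= m * N (words n 0 x) by exact: (NU _ US _).
  have h1 : N (words n.+1 1 x) <= m * N (words n 1 x) + tau * N (words n 0 x).
    by apply: le_trans (ND _ _) _; apply: lerD; [exact: (NU _ US _)|exact: NT].
  have h2 : N (words n.+1 2 x) <= m * N (words n 2 x) + tau * N (words n 1 x).
    by apply: le_trans (ND _ _) _; apply: lerD; [exact: (NU _ US _)|exact: NT].
  move: h0 h1 h2.
  set w0 := N (words n 0 x); set w1 := N (words n 1 x); set w2 := N (words n 2 x).
  set v0 := N _; set v1 := N _; set v2 := N _ => h0 h1 h2 p0 p1 p2.
  have g1 : eta * v1 <= eta * (m * w1 + tau * w0) by rewrite ler_wpM2l// ltW.
  have g2 : eta ^+ 2 * v2 <= eta ^+ 2 * (m * w2 + tau * w1).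
    by rewrite ler_wpM2l// exprn_ge0// ltW.
  pose w := w0 + eta * w1 + eta ^+ 2 * w2.
  have w_ge : w0 + eta * w1 <= w by rewrite lerDl mulr_ge0// exprn_ge0// ltW.
  have w0_ge : 0 <= w0 + eta * w1 by rewrite addr_ge0// mulr_ge0// ltW.
  have q1 : tau * eta * (w0 + eta * w1) <= (rho - m) * w.
    by apply: ler_pM => //; rewrite mulr_ge0// ltW.
  rewrite -/w; have -> : rho * w = m * w + (rho - m) * w by ring.
  apply: le_trans (lerD (lexx _) q1); rewrite /w.
  apply: le_trans (lerD (lerD h0 g1) g2) _; lra.
exists (m * (eta ^- 2 * c)); first by rewrite !mulr_gt0// invr_gt0 exprn_gt0.
move=> n x; apply: le_trans (mN _) _; rewrite -!mulrA ler_pM2l//.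
have r0 : 0 <= rho ^+ n by rewrite exprn_ge0// ltW// (lt_trans m0).
rewrite ler_pdivlMl ?exprn_gt0//.
apply: (@le_trans _ _ (rho ^+ n * N x)); last first.
  by rewrite [leRHS]mulrCA ler_wpM2l.
apply: le_trans (bnd n x).
have e20 : 0 < eta ^+ 2 by rewrite exprn_gt0.
have e2e : eta ^+ 2 <= eta by rewrite expr2 -[leRHS]mulr1 ler_wpM2l// ltW.
apply: (@le_trans _ _ (eta ^+ 2 * (N (words n 0 x) + N (words n 1 x) + N (words n 2 x)))).
  rewrite ler_pM2l//; apply: le_trans (ND _ _) _; rewrite lerD2r; exact: ND.
rewrite !mulrDr lerD2r; apply: lerD; last by rewrite ler_wpM2r.
by rewrite -[leRHS]mul1r ler_wpM2r// (le_trans e2e).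
Qed.

End Words.

(** * The bound on the essential spectral radius *)

Section Opnorm.
Context {R : realType} {B : banachLatticeType R}.

Lemma opnorm_le (f : B -> B) (M : R) : 0 <= M ->
  (forall x, `|f x| <= M * `|x|) -> 0 <= opnorm f <= M.
Proof.
move=> M0 fM.
have ub : ubound [set `|f x| | x in [set x : B | `|x| <= 1]] M.
  by move=> _ [x x1 <-]; apply: le_trans (fM x) _; rewrite -[leRHS]mulr1 ler_wpM2l.
have f0 : [set `|f x| | x in [set x : B | `|x| <= 1]] `|f 0|.
  by exists 0 => //=; rewrite normr0 ler01.
apply/andP; split; last by apply: ge_sup => //; exists `|f 0|.
by apply: le_trans (ub_le_sup _ f0) => //; exists M.
Qed.

End Opnorm.

Theorem theorem1 (R : realType) (B : banachLatticeType R)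
    (P K S : {linear B -> B})
    (hP : positive_operator P) (hK : positive_operator K)
    (hS : positive_operator S)
    (hKcompact : compact_operator K)
    (hPS : has_positive_part (P \- S))
    (hPKS : positive_le P (K \+ S)) :
  ess_spectral_radius P <= spectral_radius S.
Proof.
have r0 : 0 <= spectral_radius S := spectral_radius_ge0 S.
have [T [T0 TP]] := hPS; pose U : {linear B -> B} := P \- T.
have TK : positive_le T K.
  move=> f f0; split; first by apply: T0.
  (* [K f] bounds the set defining [T f], since [P g <=: K g + S g] and [K g <=: K f]. *)
  have [_] := TP f f0; apply => _ [g [g0 gf] <-] /=.
  rewrite ble_subl_addr; have [_ PKS] := hPKS _ g0.
  by apply: ble_trans PKS _; apply: ble_addr; exact: pos_mono.
have US : positive_le U S.
  move=> f f0; split.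
    rewrite /U /= ble_sub0; have [_] := TP f f0; apply => _ [g [g0 gf] <-] /=.
    rewrite ble_subl_addr; apply: (@ble_trans _ _ (P f)); first exact: pos_mono.
    by apply: ble_addl; apply: hS.
  (* [f] itself is admissible in the supremum, so [P f - S f <=: T f]. *)
  rewrite /U /= ble_subl_addr addrC -ble_subl_addr.
  by have [h _] := TP f f0; apply: h; exists f.
have tK : tb_operator K by exact: precompact_tbounded.
have PE n x : iter n P x = iter n (fun y => T y + U y) x.
  by elim: n => [//|n /= ->]; rewrite /U /= addrC subrK.
have main e : 0 < e -> \forall n \near \oo,
    inf [set opnorm (iter n P \- K') `^ n%:R^-1
      | K' in [set K' : {linear B -> B} | compact_operator K']] <=
    spectral_radius S + e.
  move=> e0; set r := spectral_radius S in r0 *.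
  have rr1 : r < r + e / 4 by lra.
  have res m : r < m -> exists2 V : {linear B -> B}, resolvent S m V &
      exists2 c : R, 0 < c & forall x, `|V x| <= c * `|x|.
    exact: resolvent_gt_spectral_radius.
  have [m /andP[rm m1] [V mV V0]] := positive_resolvent_between hS r0 res rr1.
  have m0 : 0 < m by apply: le_lt_trans rm.
  have mrho : m < r + e / 2 by lra.
  have [C C0 CP] := few_words_bound TK US m0 mrho mV V0.
  (* As [rho < r + e], the constant [C] is eventually absorbed by [(r + e) ^+ n]. *)
  set rho := r + e / 2 in mrho CP; have rho0 : 0 < rho by apply: lt_trans mrho.
  have re0 : 0 < r + e by lra.
  have q1 : `|rho / (r + e)| < 1.
    by rewrite ger0_norm ?divr_ge0 ?ltW// ltr_pdivrMr// mul1r /rho; lra.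
  have /cvgrPdist_lt/(_ 1 ltr01) := cvg_geometric C q1.
  apply: filterS2 (nbhs_infty_gt 0) => n n0; rewrite sub0r normrN /geometric /=.
  move=> /ltW Cn.
  have Cn' : C * rho ^+ n <= (r + e) ^+ n.
    rewrite -[leRHS]mul1r -ler_pdivrMr ?exprn_gt0//.
    by apply: le_trans Cn; rewrite expr_div_n mulrA ler_norm.
  (* Subtracting the compact [many_words T U n] leaves the words with at most two letters [T]. *)
  apply: (@le_trans _ _ (opnorm (iter n P \- many_words T U n) `^ n%:R^-1)).
    apply: ge_inf; first by exists 0 => _ [K' _ <-]; exact: powR_ge0.
    by exists (many_words T U n) => //; exact: (many_words_compact TK US tK).
  have re_ge0 : 0 <= (r + e) ^+ n by rewrite exprn_ge0// ltW.
  have /andP[nrm0 nrm1] :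
      0 <= opnorm (iter n P \- many_words T U n) <= (r + e) ^+ n.
    apply: opnorm_le => // x; rewrite /= PE iter_words addrK.
    by apply: le_trans (CP n x) _; rewrite ler_wpM2r.
  apply: (@le_trans _ _ (((r + e) ^+ n) `^ n%:R^-1)).
    by apply: ge0_ler_powR; rewrite ?nnegrE.
  have nz : n%:R != 0 :> R by rewrite pnatr_eq0 -lt0n.
  by rewrite -powR_mulrn ?(ltW re0)// -powRrM mulfV// powRr1 ?(ltW re0).
rewrite /ess_spectral_radius; set u := (fun n : nat => inf _).
(* Without convergence [limn] is the default point 0, and [r0] concludes. *)
have [cu|du] := pselect (cvgn u); last by rewrite dvgP.
apply/ler_addgt0Pr => e e0; apply: limr_le => //; exact: main.
Qed.
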